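(* Let $f\in C(I,I)$ with $h(f)=0$. The following are equivalent: (1) $f$ is Li-Yorke chaotic; (2) $f$ has a scrambled pair; (3) there exist $\delta>0$ and a Cantor set $K\subset I$ that is $\delta$-scrambled; (4) $f$ has an $f$-nonseparable pair.
   Context: $I=[0,1]$, $C(I,I)$ continuous self-maps of $I$, $h(f)$ topological entropy, $\omega_f(x)$ the $\omega$-limit set of $x$. A pair $\langle x,y\rangle$ is proximal if $\liminf_n|f^n(x)-f^n(y)|=0$, asymptotic if $\lim_n|f^n(x)-f^n(y)|=0$, scrambled if proximal but not asymptotic, and $\delta$-scrambled if $\liminf_n|f^n(x)-f^n(y)|=0$ and $\limsup_n|f^n(x)-f^n(y)|\ge\delta$. A set $C$ is scrambled ($\delta$-scrambled) if every pair of distinct points of $C$ is scrambled ($\delta$-scrambled); $f$ is Li-Yorke chaotic if it has an uncountable scrambled set. Periodic portion: for $h(f)=0$ and $\omega_f(x)$ infinite, $J_k^i=[\min\omega_{f^{2^k}}(f^i(x)),\max\omega_{f^{2^k}}(f^i(x))]$ for $k\ge1$, $0\le i<2^k$; for fixed $k$ these are pairwise disjoint closed intervals and $J_{k+1}^i\cup J_{k+1}^{2^k+i}\subset J_k^i$. A nested sequence is a choice of $i_k$ with $J_1^{i_1}\supset J_2^{i_2}\supset\cdots$. A pair $\langle u,v\rangle$, $u\ne v$, is $f$-nonseparable if for some $x$ with $\omega_f(x)$ infinite there is a nested sequence of the periodic portion of $\omega_f(x)$ with $\bigcap_kJ_k^{i_k}=[u,v]$ or $[v,u]$. *)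

(* Defs.v *)
From Stdlib Require Import Reals List.
Open Scope R_scope.

Definition inI (x : R) : Prop := 0 <= x <= 1.

Definition selfmap_I (f : R -> R) : Prop :=
  (forall x, inI x -> inI (f x)) /\
  (forall x, inI x -> forall eps, eps > 0 ->
     exists del, del > 0 /\
       forall y, inI y -> Rabs (y - x) < del -> Rabs (f y - f x) < eps).

Fixpoint iter (n : nat) (f : R -> R) (x : R) : R :=
  match n with O => x | S m => f (iter m f x) end.

Definition separated_n (f : R -> R) (n : nat) (eps : R) (x y : R) : Prop :=
  exists k, (k < n)%nat /\ Rabs (iter k f x - iter k f y) > eps.

Definition sep_set (f : R -> R) (n : nat) (eps : R) (E : list R) : Prop :=
  NoDup E /\ (forall x, In x E -> inI x) /\
  (forall x y, In x E -> In y E -> x <> y -> separated_n f n eps x y).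

(** h(f) = 0 (Bowen): for every eps > 0,
    limsup_n (1/n) log s(n,eps) <= 0, where s(n,eps) is the maximal
    cardinality of an (n,eps)-separated set. Since h(f) = sup_eps of these
    (nonnegative) quantities, this is exactly h(f) = 0. *)
Definition zero_entropy (f : R -> R) : Prop :=
  forall eps eta, eps > 0 -> eta > 0 ->
    exists N : nat, forall n : nat, (n >= N)%nat ->
      forall E, sep_set f n eps E -> INR (length E) <= exp (eta * INR n).

Definition omega (f : R -> R) (x y : R) : Prop :=
  forall eps, eps > 0 -> forall N : nat,
    exists n, (n >= N)%nat /\ Rabs (iter n f x - y) < eps.

Definition infinite_set (S : R -> Prop) : Prop :=
  forall l : list R, exists y, S y /\ ~ In y l.

Definition is_min (S : R -> Prop) (m : R) : Prop := S m /\ forall y, S y -> m <= y.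
Definition is_max (S : R -> Prop) (m : R) : Prop := S m /\ forall y, S y -> y <= m.

Definition IsJ (f : R -> R) (x : R) (k i : nat) (a b : R) : Prop :=
  is_min (omega (iter (2 ^ k) f) (iter i f x)) a /\
  is_max (omega (iter (2 ^ k) f) (iter i f x)) b.

Definition proximal (f : R -> R) (x y : R) : Prop :=
  forall eps, eps > 0 -> forall N : nat,
    exists n, (n >= N)%nat /\ Rabs (iter n f x - iter n f y) < eps.

Definition asymptotic (f : R -> R) (x y : R) : Prop :=
  forall eps, eps > 0 -> exists N : nat, forall n, (n >= N)%nat ->
    Rabs (iter n f x - iter n f y) < eps.

Definition scrambled_pair (f : R -> R) (x y : R) : Prop :=
  proximal f x y /\ ~ asymptotic f x y.

Definition limsup_ge (f : R -> R) (delta x y : R) : Prop :=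
  forall eps, eps > 0 -> forall N : nat,
    exists n, (n >= N)%nat /\ Rabs (iter n f x - iter n f y) > delta - eps.

Definition delta_scrambled_pair (f : R -> R) (delta x y : R) : Prop :=
  proximal f x y /\ limsup_ge f delta x y.

Definition scrambled_set (f : R -> R) (C : R -> Prop) : Prop :=
  forall x y, C x -> C y -> x <> y -> scrambled_pair f x y.

Definition delta_scrambled_set (f : R -> R) (delta : R) (C : R -> Prop) : Prop :=
  forall x y, C x -> C y -> x <> y -> delta_scrambled_pair f delta x y.

Definition uncountable (C : R -> Prop) : Prop :=
  ~ exists g : R -> nat, forall x y, C x -> C y -> g x = g y -> x = y.

Definition li_yorke_chaotic (f : R -> R) : Prop :=
  exists C : R -> Prop, (forall x, C x -> inI x) /\ uncountable C /\ scrambled_set f C.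

(** Cantor set in I: nonempty, closed (hence compact, as K ⊆ I), perfect,
    totally disconnected (for subsets of R: contains no nondegenerate interval). *)
Definition cantor_set_in_I (K : R -> Prop) : Prop :=
  (forall x, K x -> inI x) /\
  (exists x, K x) /\
  (forall y, (forall eps, eps > 0 -> exists z, K z /\ Rabs (z - y) < eps) -> K y) /\
  (forall x, K x -> forall eps, eps > 0 -> exists z, K z /\ z <> x /\ Rabs (z - x) < eps) /\
  (forall a b, a < b -> exists z, a < z < b /\ ~ K z).

Definition nonseparable_pair (f : R -> R) (u v : R) : Prop :=
  u <> v /\
  exists x, inI x /\ infinite_set (omega f x) /\
  exists (i : nat -> nat) (a b : nat -> R),
    (forall k, (k >= 1)%nat -> (i k < 2 ^ k)%nat /\ IsJ f x k (i k) (a k) (b k)) /\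
    (forall k, (k >= 1)%nat -> a k <= a (S k) /\ b (S k) <= b k) /\
    (forall z, (forall k, (k >= 1)%nat -> a k <= z <= b k) <->
               Rmin u v <= z <= Rmax u v).

(* Main.v *)
Require Import Defs.
From Stdlib Require Import Reals List.
From Stdlib Require Import Lra Lia Arith Classical ClassicalEpsilon FinFun Cantor.
Open Scope R_scope.

(** Zero entropy enters only through the absence of horseshoes for all iterates. This forces an orbit
    with infinite omega-limit set to alternate, from some time on, around a fixed point; applied
    to the iterates [f^(2^k)], it splits the omega-limit set, which contains no periodic
    point, into [2^k] pieces with disjoint hulls.

    For a scrambled pair, choose nested residue classes [i_k mod 2^k] along which the two orbits stay
    a fixed distance apart infinitely often. The corresponding hulls for the two points meet, so
    those of one of the points do not shrink, which gives a nonseparable pair.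

    Conversely, let [u, v] be nonseparable. Any small interval next to [u] contains two orbit points
    whose times differ by an odd multiple of some [2^m]; by the alternation, its images
    eventually contain all late orbit points of one residue class, in particular points near [u]
    and near [v]. The same holds at [v], so there are "horseshoes" with legs shrinking to [u] and [v].
    The points following suitable sequences of legs form a Cantor set, scrambled with [delta = |u - v|]. *)

(** * Real functions and horseshoes *)

(** Zero entropy forbids two fixed intervals whose images each cover both of them, so no ordinary
    horseshoe is available. What remains possible is a covering from stage to stage, in a time that
    depends on the stage. Expansion reaches only late orbit points of one residue class modulo a
    power of two. The two legs must therefore reach the same class, and this class must accumulate
    at both [u] and [v]. Hence the care with residues: a nonseparable pair is defined by nested
    intervals, and it is the disjointness of the hulls that makes the residues nested as well; the
    common expansion time is then taken to be a multiple of the modulus. Finite omega-limit sets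
    have to be excluded for a scrambled pair. An orbit with such a limit set shadows a finite orbit,
    which makes a proximal pair asymptotic or puts a periodic point into the other, infinite,
    omega-limit set. *)

Lemma iter_add f n m x : iter (n + m) f x = iter n f (iter m f x).
Proof. induction n; simpl; congruence. Qed.

Lemma iter_mul f n m x : iter n (iter m f) x = iter (n * m) f x.
Proof.
  induction n; simpl; auto. rewrite IHn, <- iter_add. reflexivity.
Qed.

Lemma iter_S_r f n x : iter (S n) f x = iter n f (f x).
Proof. replace (S n) with (n + 1)%nat by lia. now rewrite iter_add. Qed.

Lemma iter_fix f n x : f x = x -> iter n f x = x.
Proof. intros H; induction n; simpl; congruence. Qed.

Lemma Rabs_le_bounds x a : Rabs x <= a -> - a <= x <= a.
Proof. unfold Rabs. destruct Rcase_abs; lra. Qed.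

Lemma continuity_iter f n : continuity f -> continuity (iter n f).
Proof.
  intros H. induction n.
  - exact (derivable_continuous _ derivable_id).
  - exact (continuity_comp _ _ IHn H).
Qed.

Lemma continuity_modulus f x : continuity f -> forall eps, eps > 0 ->
  exists del, del > 0 /\ forall y, Rabs (y - x) < del -> Rabs (f y - f x) < eps.
Proof.
  intros H eps He. destruct (H x eps He) as (d & Hd & Hx).
  exists d; split; auto. intros y Hy.
  destruct (Req_dec y x) as [->|Hn].
  - replace (f x - f x) with 0 by ring. rewrite Rabs_R0; lra.
  - apply (Hx y). split; [split; [exact I | auto] | exact Hy].
Qed.

Lemma ivt f a b c : continuity f -> a <= b -> f a <= c <= f b ->
  exists x, a <= x <= b /\ f x = c.
Proof.
  intros Hf Hab Hc.
  assert (Hg : continuity (fun x => f x - c)).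
  { apply continuity_minus; auto. apply continuity_const. intros ? ?; auto. }
  destruct (IVT_cor (fun x => f x - c) a b Hg Hab) as (z & Hz & E).
  - assert (0 <= (c - f a) * (f b - c)) by (apply Rmult_le_pos; lra). lra.
  - exists z; split; auto. lra.
Qed.

Lemma ivt_dec f a b c : continuity f -> a <= b -> f b <= c <= f a ->
  exists x, a <= x <= b /\ f x = c.
Proof.
  intros Hf Hab Hc.
  destruct (ivt (fun x => - f x) a b (- c)) as (x & Hx & E); auto; try lra.
  - apply continuity_opp; auto.
  - exists x; split; auto. lra.
Qed.

Lemma ivt_any f a b c : continuity f -> f a <= c <= f b ->
  exists x, Rmin a b <= x <= Rmax a b /\ f x = c.
Proof.
  intros Hf Hc. destruct (Rle_dec a b).
  - rewrite Rmin_left, Rmax_right by lra. apply ivt; auto.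
  - rewrite Rmin_right, Rmax_left by lra. apply ivt_dec; auto; lra.
Qed.

(** The sign of [h] before the zero matters later, so the zero is taken as the supremum of the [t]
    such that [h] is negative on all of [[a, t]]. *)
Lemma first_zero h a b : continuity h -> a < b -> h a < 0 -> 0 <= h b ->
  exists z, a < z <= b /\ h z = 0 /\ forall y, a <= y < z -> h y < 0.
Proof.
  intros Hh Hab Ha Hb.
  set (E := fun t => a <= t <= b /\ forall y, a <= y <= t -> h y < 0).
  destruct (completeness E) as (z & Hub & Hlub).
  - exists b. intros t (Ht & _). lra.
  - exists a. split; [lra|]. intros y Hy. replace y with a by lra. auto.
  - assert (Haz : a <= z).
    { apply Hub. split; [lra|]. intros y Hy. replace y with a by lra. auto. }
    assert (Hzb : z <= b) by (apply Hlub; intros t (Ht & _); lra).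
    assert (Hlt : forall y, a <= y < z -> h y < 0).
    { intros y Hy. destruct (classic (exists t, E t /\ y < t)) as [(t & (_ & Ht) & Hyt)|Hn].
      - apply Ht; lra.
      - exfalso. assert (z <= y); [|lra]. apply Hlub. intros t Ht.
        destruct (Rle_dec t y); auto. exfalso; apply Hn; exists t; split; auto; lra. }
    assert (Hz0 : h z = 0).
    { destruct (Rtotal_order (h z) 0) as [Hz|[Hz|Hz]]; auto; exfalso.
      - destruct (continuity_modulus h z Hh (- h z)) as (d & Hd & Hc); [lra|].
        assert (z < b) by (destruct (Req_dec z b); [subst; lra | lra]).
        set (t := Rmin (z + d / 2) b).
        assert (t <= z + d/2) by apply Rmin_l. assert (t <= b) by apply Rmin_r.
        assert (z < t) by (apply Rmin_glb_lt; lra).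
        assert (t <= z); [|lra]. apply Hub. split; [lra|]. intros y Hy.
        destruct (Rlt_dec y z); [apply Hlt; lra|].
        specialize (Hc y). assert (Rabs (y - z) < d) by (rewrite Rabs_right; lra).
        specialize (Hc H3). apply Rabs_def2 in Hc. lra.
      - destruct (continuity_modulus h z Hh (h z)) as (d & Hd & Hc); [lra|].
        assert (a < z) by (destruct (Req_dec z a); [subst; lra | lra]).
        set (y := Rmax a (z - d/2)).
        assert (z - d/2 <= y) by apply Rmax_r. assert (a <= y) by apply Rmax_l.
        assert (y < z) by (apply Rmax_lub_lt; lra).
        specialize (Hlt y (conj H1 H2)).
        assert (Rabs (y - z) < d) by (rewrite Rabs_left; lra).
        apply Hc in H3. apply Rabs_def2 in H3. lra. }
    exists z; repeat split; auto.
    destruct (Req_dec z a); [subst; lra|lra].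
Qed.

Lemma last_zero h a b : continuity h -> a < b -> 0 <= h a -> h b < 0 ->
  exists z, a <= z < b /\ h z = 0 /\ forall y, z < y <= b -> h y < 0.
Proof.
  intros Hh Hab Ha Hb.
  destruct (first_zero (fun x => h (- x)) (- b) (- a)) as (z & Hz & E & Hl);
    rewrite ?Ropp_involutive; try lra.
  - apply (continuity_comp (fun x => - x) h); auto.
    apply (continuity_opp (fun x => x)), derivable_continuous, derivable_id.
  - exists (- z); repeat split; auto; try lra.
    intros y Hy. specialize (Hl (- y)). rewrite Ropp_involutive in Hl. apply Hl; lra.
Qed.

(** Quantifying over all iterates makes the property pass from [f] to its powers, to which the later
    statements are applied. *)
Definition no_horseshoe (f : R -> R) : Prop :=
  forall n a b c d, (1 <= n)%nat -> a <= b -> b < c -> c <= d ->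
  (forall p, a <= p <= b \/ c <= p <= d -> exists q, a <= q <= b /\ iter n f q = p) ->
  (forall p, a <= p <= b \/ c <= p <= d -> exists q, c <= q <= d /\ iter n f q = p) ->
  False.

(** Boundedness replaces compactness of the domain: it gives a fixed point below any point that
    moves down, and limit points of orbits. *)
Definition good (f : R -> R) : Prop :=
  continuity f /\ (exists M, forall x, Rabs (f x) <= M) /\ no_horseshoe f.

(** Conjugation by the reflection [x -> -x], which carries a statement about one side over to the
    other. *)
Definition opp_conj (f : R -> R) (x : R) : R := - f (- x).

Lemma iter_opp_conj f n x : iter n (opp_conj f) x = - iter n f (- x).
Proof.
  revert x; induction n; intros; simpl.
  - now rewrite Ropp_involutive.
  - rewrite IHn. unfold opp_conj. now rewrite Ropp_involutive.
Qed.

Lemma good_opp_conj f : good f -> good (opp_conj f).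
Proof.
  intros (Hc & (M & HM) & Hh). split; [|split].
  - unfold opp_conj. apply continuity_opp. apply (continuity_comp (fun x => - x) f); auto.
    apply (continuity_opp (fun x => x)), derivable_continuous, derivable_id.
  - exists M. intros x. unfold opp_conj. rewrite Rabs_Ropp. auto.
  - intros n a b c d Hn Hab Hbc Hcd H1 H2.
    apply (Hh n (- d) (- c) (- b) (- a)); auto; try lra; intros p Hp.
    + destruct (H2 (- p)) as (q & Hq & E); [lra|]. exists (- q). split; [lra|].
      rewrite iter_opp_conj in E. lra.
    + destruct (H1 (- p)) as (q & Hq & E); [lra|]. exists (- q). split; [lra|].
      rewrite iter_opp_conj in E. lra.
Qed.

Lemma good_iter f r : (1 <= r)%nat -> good f -> good (iter r f).
Proof.
  intros Hr (Hc & (M & HM) & Hh). split; [|split].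
  - now apply continuity_iter.
  - exists M. intros x. destruct r; [lia|]. simpl. auto.
  - intros n a b c d Hn Hab Hbc Hcd H1 H2.
    apply (Hh (n * r)%nat a b c d); auto; try nia; intros p Hp.
    + destruct (H1 p Hp) as (q & Hq & E). exists q. rewrite iter_mul in E. auto.
    + destruct (H2 p Hp) as (q & Hq & E). exists q. rewrite iter_mul in E. auto.
Qed.

(** The graph climbs from at most [w] to above [y'] and falls back to at most [w]. The laps [[w, s]]
    and [[t, y']], cut where [g] takes the value [y'], both cover [[w, y']]; the strict overshoot
    [y' < g y] keeps them disjoint. *)
Lemma good_lt g w y y' : good g -> w < y -> y < y' ->
  g w <= w -> y' < g y -> g y' <= w -> False.
Proof.
  intros (Hc & _ & Hh) H1 H2 Gw Gy Gy'.
  destruct (ivt g w y y') as (s & Hs & Es); auto; try lra.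
  destruct (ivt_dec g y y' y') as (t & Ht & Et); auto; try lra.
  assert (s < t).
  { destruct (Req_dec s y); [subst; lra|]. lra. }
  apply (Hh 1%nat w s t y'); try lia; try lra; intros p Hp; simpl.
  - apply ivt; auto; lra.
  - apply ivt_dec; auto; lra.
Qed.

(* When [g y = y'] the two laps touch; the laps [w,y] -> [y,y'] of [g^2] then overshoot. *)
Lemma good_le g w y y' : good g -> w < y -> y < y' ->
  g w <= w -> y' <= g y -> g y' <= w -> False.
Proof.
  intros Hg H1 H2 Gw Gy Gy'. assert (Hc := proj1 Hg).
  (* [w'], [s], [t] are preimages of [w], [y], [y'], in this order in [[w, y]]. Under [g^2] they go
     to at most [w], at least [y'], at most [w], and [t <= y < y'] makes the overshoot strict. *)
  destruct (ivt g w y w) as (w' & Hw' & Ew); auto; try lra.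
  destruct (ivt g w' y y) as (s & Hs & Es); auto; try lra.
  destruct (ivt g s y y') as (t & Ht & Et); auto; try lra.
  assert (s <> t) by (intros ->; lra). assert (s <> w') by (intros ->; lra).
  assert (E1 : iter 2 g w' <= w') by (simpl; rewrite Ew; lra).
  assert (E2 : t < iter 2 g s) by (simpl; rewrite Es; lra).
  assert (E3 : iter 2 g t <= w') by (simpl; rewrite Et; lra).
  apply (good_lt (iter 2 g) w' s t); auto; try lra.
  apply good_iter; auto.
Qed.

Lemma good_ge g w y y' : good g -> y' < y -> y < w ->
  w <= g w -> g y <= y' -> w <= g y' -> False.
Proof.
  intros Hg H1 H2 Gw Gy Gy'.
  apply (good_le (opp_conj g) (- w) (- y) (- y')); unfold opp_conj; rewrite ?Ropp_involutive; try lra.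
  now apply good_opp_conj.
Qed.

(** * Entropy *)

Definition clamp (x : R) : R := Rmax 0 (Rmin x 1).

(** Constant continuation outside the unit interval: orbits inside are unchanged, and continuity on
    the whole line spares domain conditions in the intermediate value arguments. *)
Definition extend (f : R -> R) (x : R) : R := f (clamp x).

Lemma clamp_inI x : inI (clamp x).
Proof.
  unfold clamp, inI. split; [apply Rmax_l|]. apply Rmax_lub; [lra|apply Rmin_r].
Qed.

Lemma clamp_id x : inI x -> clamp x = x.
Proof. intros [H1 H2]. unfold clamp. rewrite Rmin_left, Rmax_right; auto. Qed.

Lemma clamp_lipschitz x y : Rabs (clamp x - clamp y) <= Rabs (x - y).
Proof.
  unfold clamp, Rmin. destruct (Rle_dec x 1), (Rle_dec y 1);
    unfold Rmax; repeat destruct Rle_dec; unfold Rabs; repeat destruct Rcase_abs; lra.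
Qed.

Lemma extend_inI f x : selfmap_I f -> inI (extend f x).
Proof. intros H. apply H, clamp_inI. Qed.

Lemma iter_inI f n x : selfmap_I f -> inI x -> inI (iter n f x).
Proof. intros Hf Hx. induction n; simpl; auto. now apply Hf. Qed.

Lemma iter_extend f n x : selfmap_I f -> inI x -> iter n (extend f) x = iter n f x.
Proof.
  intros Hf Hx. induction n; simpl; auto. rewrite IHn. unfold extend.
  rewrite clamp_id; auto. now apply iter_inI.
Qed.

Lemma continuity_extend f : selfmap_I f -> continuity (extend f).
Proof.
  intros Hf x eps He. destruct (proj2 Hf (clamp x) (clamp_inI x) eps He) as (d & Hd & H).
  exists d; split; auto. intros y [_ Hy]. simpl in *. unfold Rdist in *.
  apply H; [apply clamp_inI|].
  apply Rle_lt_trans with (2 := Hy), clamp_lipschitz.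
Qed.

(** Each word of length [m] in the two legs is followed by a point obtained by pulling back. Where
    two words first differ, their points are in different legs, at distance at least [c - b]; half
    of that meets the strict inequality in [separated_n]. *)
Lemma separated_words g n a b c d : (1 <= n)%nat -> a <= b -> b < c -> c <= d ->
  (forall p, a <= p <= b \/ c <= p <= d -> exists q, a <= q <= b /\ iter n g q = p) ->
  (forall p, a <= p <= b \/ c <= p <= d -> exists q, c <= q <= d /\ iter n g q = p) ->
  forall m, exists E : list R, length E = (2 ^ m)%nat /\ NoDup E /\
    (forall x, In x E -> a <= x <= b \/ c <= x <= d) /\
    (forall x y, In x E -> In y E -> x <> y -> separated_n g (m * n) ((c - b) / 2) x y).
Proof.
  intros Hn Hab Hbc Hcd H1 H2.
  set (V := fun p => a <= p <= b \/ c <= p <= d) in *.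
  set (pa := fun p => epsilon (inhabits 0) (fun q => a <= q <= b /\ iter n g q = p)).
  set (pc := fun p => epsilon (inhabits 0) (fun q => c <= q <= d /\ iter n g q = p)).
  assert (Ha : forall p, V p -> a <= pa p <= b /\ iter n g (pa p) = p).
  { intros p Hp. apply (epsilon_spec (inhabits 0) _ (H1 p Hp)). }
  assert (Hc : forall p, V p -> c <= pc p <= d /\ iter n g (pc p) = p).
  { intros p Hp. apply (epsilon_spec (inhabits 0) _ (H2 p Hp)). }
  clearbody pa pc.
  assert (Hinj : forall h E, (forall p, V p -> iter n g (h p) = p) -> (forall x, In x E -> V x) ->
    NoDup E -> NoDup (map h E)).
  { intros h E Hh HE HN. induction HN; simpl; constructor.
    - intros Hin. apply in_map_iff in Hin. destruct Hin as (y & Ey & Hy).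
      assert (E1 := Hh x (HE x (or_introl eq_refl))).
      assert (E2 := Hh y (HE y (or_intror Hy))).
      rewrite Ey in E2. rewrite E2 in E1. subst. contradiction.
    - apply IHHN. intros y Hy; apply HE; now right. }
  assert (Hshift : forall m x y, separated_n g (m * n) ((c - b) / 2) (iter n g x) (iter n g y) ->
     separated_n g (S m * n) ((c - b)/2) x y).
  { intros m x y (k & Hk & Hs). exists (k + n)%nat. split; [simpl; lia|].
    now rewrite !iter_add. }
  induction m as [|m (E & HL & HN & HV & HS)].
  - exists (a :: nil). simpl. split; [auto|]. split; [constructor; auto; constructor|]. split.
    + intros x [<-|[]]. left; lra.
    + intros x y [<-|[]] [<-|[]] Hxy. now contradict Hxy.
  - exists (map pa E ++ map pc E). split; [|split; [|split]].
    + rewrite length_app, !length_map, HL. simpl. lia.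
    + apply NoDup_app.
      * apply Hinj; auto. intros; now apply Ha.
      * apply Hinj; auto. intros; now apply Hc.
      * intros x Hx Hx'. apply in_map_iff in Hx. apply in_map_iff in Hx'.
        destruct Hx as (p & <- & Hp), Hx' as (q & Eq & Hq).
        assert (A := Ha p (HV p Hp)). assert (B := Hc q (HV q Hq)). lra.
    + intros x Hx. apply in_app_iff in Hx.
      destruct Hx as [Hx|Hx]; apply in_map_iff in Hx; destruct Hx as (p & <- & Hp).
      * left; now apply Ha, HV.
      * right; now apply Hc, HV.
    + assert (Hac : forall p q, In p E -> In q E -> pc q - pa p > (c - b) / 2).
      { intros p q Hp Hq. assert (A := Ha p (HV p Hp)). assert (B := Hc q (HV q Hq)). lra. }
      intros x y Hx Hy Hxy. apply in_app_iff in Hx. apply in_app_iff in Hy.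
      destruct Hx as [Hx|Hx], Hy as [Hy|Hy]; apply in_map_iff in Hx; apply in_map_iff in Hy;
        destruct Hx as (p & <- & Hp), Hy as (q & <- & Hq).
      * apply Hshift. destruct (Ha p (HV p Hp)) as [_ ->], (Ha q (HV q Hq)) as [_ ->].
        apply HS; auto. congruence.
      * exists 0%nat. split; [simpl; lia|]. simpl. specialize (Hac p q Hp Hq).
        rewrite Rabs_left; lra.
      * exists 0%nat. split; [simpl; lia|]. simpl. specialize (Hac q p Hq Hp).
        rewrite Rabs_right; lra.
      * apply Hshift. destruct (Hc p (HV p Hp)) as [_ ->], (Hc q (HV q Hq)) as [_ ->].
        apply HS; auto. congruence.
Qed.

Lemma zero_entropy_no_horseshoe f : selfmap_I f -> zero_entropy f -> no_horseshoe (extend f).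
Proof.
  intros Hf Hh n a b c d Hn Hab Hbc Hcd H1 H2.
  assert (Hn0 : 0 < INR n) by (apply lt_0_INR; lia).
  assert (Hl2 : 0 < ln 2) by (rewrite <- ln_1; apply ln_increasing; lra).
  (* The horseshoe gives [2^m] separated points in [m * n] steps, a growth rate of [ln 2 / n]; half
     this rate is refuted at [m = S N], which is past the threshold [N]. *)
  destruct (Hh ((c - b) / 2) (ln 2 / (2 * INR n))) as (N & HN); [lra| |].
  { apply Rdiv_lt_0_compat; lra. }
  destruct (separated_words (extend f) n a b c d Hn Hab Hbc Hcd H1 H2 (S N))
    as (E & HL & HD & HV & HS).
  assert (HI : forall x, In x E -> inI x).
  { intros x Hx. destruct (H1 x (HV x Hx)) as (q & _ & <-).
    destruct n; [lia|]. simpl. now apply extend_inI. }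
  specialize (HN (S N * n)%nat). assert (Hge : (S N * n >= N)%nat) by nia.
  specialize (HN Hge E). rewrite HL in HN.
  assert (HE : INR (2 ^ S N) <= exp (ln 2 / (2 * INR n) * INR (S N * n))).
  { apply HN. split; [auto|split; [auto|]]. intros x y Hx Hy Hxy.
    destruct (HS x y Hx Hy Hxy) as (k & Hk & Hs). exists k. split; auto.
    rewrite !iter_extend in Hs; auto. }
  rewrite mult_INR in HE.
  replace (ln 2 / (2 * INR n) * (INR (S N) * INR n)) with (INR (S N) * ln 2 / 2) in HE
    by (field; lra).
  assert (HP : INR (2 ^ S N) = exp (INR (S N) * ln 2)).
  { rewrite pow_INR. simpl (INR 2). replace (1 + 1) with 2 by ring.
    rewrite <- Rpower_pow by lra. reflexivity. }
  rewrite HP in HE.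
  assert (HS0 : 0 < INR (S N) * ln 2).
  { apply Rmult_lt_0_compat; auto. apply lt_0_INR; lia. }
  assert (exp (INR (S N) * ln 2 / 2) < exp (INR (S N) * ln 2)) by (apply exp_increasing; lra).
  lra.
Qed.

Lemma good_extend f : selfmap_I f -> zero_entropy f -> good (extend f).
Proof.
  intros Hf Hh. split; [|split].
  - now apply continuity_extend.
  - exists 1. intros x. destruct (extend_inI f x Hf). rewrite Rabs_right; lra.
  - now apply zero_entropy_no_horseshoe.
Qed.

(** * Separation of rising and falling orbit points *)

Lemma continuity_drift g : continuity g -> continuity (fun x => g x - x).
Proof.
  intros H. apply (continuity_minus g (fun x => x)); auto.
  apply derivable_continuous, derivable_id.
Qed.

Lemma continuity_drift' g : continuity g -> continuity (fun x => x - g x).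
Proof.
  intros H. apply (continuity_minus (fun x => x) g); auto.
  apply derivable_continuous, derivable_id.
Qed.

Lemma last_fixpoint_below g p : good g -> g p < p ->
  exists w, w < p /\ g w = w /\ forall y, w < y <= p -> g y < y.
Proof.
  intros (Hc & (M & HM) & _) Hp.
  assert (B1 := HM p). assert (B2 := HM (- M - 1)). apply Rabs_le_bounds in B1, B2.
  (* All values of [g] exceed [- M - 1], so this point moves up. *)
  destruct (last_zero (fun x => g x - x) (- M - 1) p) as (w & Hw & E & Hl); try lra.
  - now apply continuity_drift.
  - exists w. repeat split; try lra. intros y Hy. specialize (Hl y Hy). lra.
Qed.

(* With [w] and [z] the fixed points nearest to [p], the orbit of [p] leaves ]w,z[ from a point
   [y] with [g y <= w]; some [y'] in ]y,z[ is mapped to [w], and the return to [g^j p > z]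
   closes a horseshoe. *)
Lemma no_return_from_down_to_up g p j : good g ->
  g p < p -> p < iter j g p -> iter j g p < g (iter j g p) -> False.
Proof.
  intros Hg Hp Hj Hq. assert (Hc := proj1 Hg).
  destruct (last_fixpoint_below g p Hg Hp) as (w & Hwp & Ew & Hw).
  destruct (first_zero (fun x => g x - x) p (iter j g p)) as (z & Hz & Ez & Hl); try lra.
  { now apply continuity_drift. }
  assert (Hdown : forall y, w < y < z -> g y < y).
  { intros y Hy. destruct (Rle_dec y p); [apply Hw; lra|]. specialize (Hl y). simpl in Hl. lra. }
  assert (Hex : exists i, (i < j)%nat /\ w < iter i g p < z /\ iter (S i) g p <= w).
  { apply NNPP. intros Hn.
    assert (Hin : forall i, (i <= j)%nat -> w < iter i g p < z).
    { induction i; intros Hi; [simpl; lra|].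
      assert (Hi' := IHi ltac:(lia)). assert (D := Hdown _ Hi').
      destruct (Rle_lt_dec (iter (S i) g p) w) as [Hle|Hlt].
      - exfalso. apply Hn. exists i. auto.
      - simpl in *. lra. }
    specialize (Hin j (le_n j)). lra. }
  destruct Hex as (i & Hi & Hy & Hgy). simpl in Hgy.
  set (y := iter i g p) in *.
  destruct (ivt g y z w) as (y' & Hy' & Ey'); auto; try lra.
  assert (EN : iter (j - i) g y = iter j g p).
  { unfold y. rewrite <- iter_add. f_equal. lia. }
  assert (Hyz : y' <> z) by (intros ->; lra).
  assert (EN' : iter (j - i) g y' = w).
  { replace (j - i)%nat with (S (j - i - 1)) by lia. rewrite iter_S_r, Ey'.
    now apply iter_fix. }
  assert (y <> y') by (intros E; rewrite E in EN; lra).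
  apply (good_le (iter (j - i) g) w y y'); try lra.
  - apply good_iter; auto; lia.
  - rewrite iter_fix; auto. lra.
Qed.

Lemma no_return_from_up_to_down g p j : good g ->
  p < g p -> iter j g p < p -> g (iter j g p) < iter j g p -> False.
Proof.
  intros Hg H1 H2 H3.
  apply (no_return_from_down_to_up (opp_conj g) (- p) j); rewrite ?iter_opp_conj; unfold opp_conj;
    rewrite ?Ropp_involutive; try lra.
  now apply good_opp_conj.
Qed.

(** Weaker than alternation: rising points are left of [z] and falling points right of it, but the
    orbit may stay on one side for several steps. *)
Definition straddles (g : R -> R) (x z : R) : Prop :=
  g z = z /\ forall n, (iter n g x < z /\ iter n g x < iter (S n) g x) \/
                       (z < iter n g x /\ iter (S n) g x < iter n g x).

Lemma straddles_opp_conj g x z : straddles g x z -> straddles (opp_conj g) (- x) (- z).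
Proof.
  intros (E & H). split.
  - unfold opp_conj. rewrite Ropp_involutive. lra.
  - intros n. rewrite !iter_opp_conj, Ropp_involutive. specialize (H n). lra.
Qed.

(** The no-return lemmas put every rising orbit point below every falling one. If [s] is the
    supremum of the rising ones, then [s <= g s] by continuity; the first fixed point [z >= s] is
    still below all falling points, since [g] moves points up between [s] and [z]. *)
Lemma exists_straddled g x : good g -> (forall n, g (iter n g x) <> iter n g x) ->
  (exists n, iter n g x < iter (S n) g x) -> (exists n, iter (S n) g x < iter n g x) ->
  exists z, straddles g x z.
Proof.
  intros Hg Hnf (nu & Hu) (nd & Hd). assert (Hc := proj1 Hg). simpl in Hu, Hd.
  set (X := fun n => iter n g x).
  change (X nu < g (X nu)) in Hu. change (g (X nd) < X nd) in Hd.
  assert (HUD : forall i j, X i < g (X i) -> g (X j) < X j -> X i < X j).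
  { intros i j Hi Hj. destruct (Rlt_le_dec (X i) (X j)) as [|Hle]; auto. exfalso.
    destruct (Req_dec (X i) (X j)) as [E|Hne]; [rewrite E in Hi; lra|].
    destruct (le_lt_dec i j) as [Hij|Hij].
    - apply (no_return_from_up_to_down g (X i) (j - i)); auto; unfold X in *;
        rewrite <- iter_add; replace (j - i + i)%nat with j by lia; lra.
    - apply (no_return_from_down_to_up g (X j) (i - j)); auto; unfold X in *;
        rewrite <- iter_add; replace (i - j + j)%nat with i by lia; lra. }
  destruct (completeness (fun y => exists i, X i < g (X i) /\ y = X i)) as (s & Hub & Hlub).
  { exists (X nd). intros y (i & Hi & ->). left. now apply HUD. }
  { exists (X nu). exists nu. auto. }
  assert (HU : forall i, X i < g (X i) -> X i <= s) by (intros i Hi; apply Hub; eauto).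
  assert (HD : forall j, g (X j) < X j -> s <= X j).
  { intros j Hj. apply Hlub. intros y (i & Hi & ->). left. now apply HUD. }
  assert (Hs : s <= g s).
  { destruct (Rle_lt_dec s (g s)) as [|Hlt]; auto. exfalso.
    destruct (continuity_modulus (fun y => g y - y) s (continuity_drift g Hc) (s - g s))
      as (e & He & Hm); [lra|].
    assert (s <= s - e); [|lra]. apply Hlub. intros y (i & Hi & ->).
    destruct (Rle_lt_dec (X i) (s - e)); auto. exfalso.
    assert (Hi' := HU i Hi). specialize (Hm (X i)).
    assert (Hr : Rabs (X i - s) < e) by (apply Rabs_def1; lra).
    apply Hm, Rabs_def2 in Hr. lra. }
  assert (Hz : exists z, g z = z /\ s <= z /\ forall j, g (X j) < X j -> z <= X j).
  { destruct (Req_dec (g s) s) as [E|Hne]; [exists s; split; [auto|split; [lra|auto]]|].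
    assert (A := HD nd Hd). assert (s <> X nd) by (intros E; rewrite <- E in Hd; lra).
    destruct (first_zero (fun y => y - g y) s (X nd)) as (z & Hz & Ez & Hl); try lra.
    { now apply continuity_drift'. }
    exists z. split; [lra|split; [lra|]]. intros j Hj.
    destruct (Rle_lt_dec z (X j)) as [|Hlt]; auto.
    specialize (Hl (X j) (conj (HD j Hj) Hlt)). simpl in Hl. lra. }
  destruct Hz as (z & Ez & Hsz & Hzd).
  exists z. split; auto. intros n. fold (X n).
  change (iter (S n) g x) with (g (X n)). specialize (Hnf n). fold (X n) in Hnf.
  assert (X n <> z) by (intros E; apply Hnf; now rewrite E).
  destruct (Rtotal_order (g (X n)) (X n)) as [H1|[H1|H1]]; [|contradiction|].
  - right. specialize (Hzd n H1). lra.
  - left. specialize (HU n H1). lra.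
Qed.

(** At a first failure [k], the point at time [k - 1] must be right of [z]. So [g^(k-j-1)] fixes
    [z], sends the point at time [j] beyond [z] and the point at time [j + 1] to at most the one at
    time [j]: the configuration of [good_ge]. *)
Lemma no_return_after_stay_left g x z j k : good g -> straddles g x z ->
  iter (S j) g x < z -> (j < k)%nat -> iter j g x < z -> iter j g x < iter k g x.
Proof.
  intros Hg (Ez & Hs) Hj1 Hjk Hj.
  set (X := fun n => iter n g x) in *.
  change (X j < X k). change (X j < z) in Hj. change (X (S j) < z) in Hj1.
  revert Hjk. induction k as [k IH] using lt_wf_ind. intros Hjk.
  destruct (Rlt_le_dec (X j) (X k)) as [|Hle]; auto. exfalso.
  assert (Hup : X j < X (S j)) by (specialize (Hs j); fold (X j) (X (S j)) in Hs; lra).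
  assert (k <> S j) by (intros ->; lra).
  assert (HIH := IH (k - 1)%nat ltac:(lia) ltac:(lia)).
  assert (Hk : z < X (k - 1)%nat).
  { specialize (Hs (k - 1)%nat). replace (S (k - 1)) with k in Hs by lia.
    fold (X k) (X (k - 1)%nat) in Hs. lra. }
  assert (E1 : iter (k - S j) g (X (S j)) = X k).
  { unfold X. rewrite <- iter_add. f_equal; lia. }
  assert (E2 : iter (k - S j) g (X j) = X (k - 1)%nat).
  { unfold X. rewrite <- iter_add. f_equal; lia. }
  apply (good_ge (iter (k - S j) g) z (X (S j)) (X j)); try lra.
  - apply good_iter; auto; lia.
  - rewrite iter_fix; auto; lra.
Qed.

Lemma no_return_after_stay_right g x z j k : good g -> straddles g x z ->
  z < iter (S j) g x -> (j < k)%nat -> z < iter j g x -> iter k g x < iter j g x.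
Proof.
  intros Hg Hs H1 Hjk H2.
  assert (A := no_return_after_stay_left (opp_conj g) (- x) (- z) j k (good_opp_conj g Hg)
    (straddles_opp_conj g x z Hs)).
  rewrite !iter_opp_conj, Ropp_involutive in A. specialize (A ltac:(lra) Hjk ltac:(lra)). lra.
Qed.

(** A periodic orbit comes back to each of its points, so it can never stay on one side of the fixed
    point it straddles. It therefore changes sides at every step and cannot close up after an odd
    number of steps. *)
Lemma odd_periodic_fixed g n v : good g -> Nat.Odd n -> iter n g v = v -> g v = v.
Proof.
  intros Hg (m & Hm) Hv. destruct (Req_dec (g v) v) as [|Hne]; auto. exfalso.
  assert (Hper : forall i j, iter (j * n + i) g v = iter i g v).
  { intros i j. induction j; [auto|].
    replace (S j * n + i)%nat with (j * n + i + n)%nat by lia. now rewrite iter_add, Hv. }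
  assert (Hnf : forall i, g (iter i g v) <> iter i g v).
  { intros i E. apply Hne.
    assert (E1 : forall k, iter (k + i) g v = iter i g v).
    { intros k. rewrite iter_add. now apply iter_fix. }
    (* Going on from time [i] to the multiple [i * n] of the period leads back to [v], so [v] would
       be the fixed point. *)
    assert (A := E1 (n * i - i)%nat). replace (n * i - i + i)%nat with (i * n + 0)%nat in A by nia.
    rewrite Hper in A. simpl in A. rewrite <- A in E. exact E. }
  assert (Hz : exists z, straddles g v z).
  { apply exists_straddled; auto; apply NNPP; intros Hn.
    - assert (Hdec : forall i, iter (S i) g v < v).
      { induction i; [destruct (Rtotal_order (g v) v) as [|[|]]; simpl; auto; [tauto|];
          exfalso; apply Hn; exists 0%nat; simpl; auto|].
        specialize (Hnf (S i)). destruct (Rtotal_order (g (iter (S i) g v)) (iter (S i) g v))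
          as [|[|]]; [simpl in *; lra|contradiction|exfalso; apply Hn; exists (S i); auto]. }
      specialize (Hdec (2 * m)%nat). replace (S (2 * m)) with n in Hdec by lia. lra.
    - assert (Hinc : forall i, v < iter (S i) g v).
      { induction i; [destruct (Rtotal_order (g v) v) as [|[|]]; simpl; auto; [|tauto];
          exfalso; apply Hn; exists 0%nat; simpl; auto|].
        specialize (Hnf (S i)). destruct (Rtotal_order (g (iter (S i) g v)) (iter (S i) g v))
          as [|[|]]; [exfalso; apply Hn; exists (S i); auto|contradiction|simpl in *; lra]. }
      specialize (Hinc (2 * m)%nat). replace (S (2 * m)) with n in Hinc by lia. lra. }
  destruct Hz as (z & Hz).
  assert (Hret : forall j, iter (j + n) g v = iter j g v).
  { intros j. rewrite iter_add. now rewrite Hv. }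
  assert (Halt : forall j, (iter j g v < z -> z < iter (S j) g v) /\
                           (z < iter j g v -> iter (S j) g v < z)).
  { intros j. specialize (Hret j). destruct (proj2 Hz (S j)) as [[A _]|[A _]]; split; intros B; auto.
    - exfalso. assert (C := no_return_after_stay_left g v z j (j + n) Hg Hz A ltac:(lia) B). lra.
    - exfalso. assert (C := no_return_after_stay_right g v z j (j + n) Hg Hz A ltac:(lia) B). lra. }
  assert (Hev : forall i, (v < z -> iter (2 * i) g v < z /\ z < iter (S (2 * i)) g v) /\
                          (z < v -> z < iter (2 * i) g v /\ iter (S (2 * i)) g v < z)).
  { induction i.
    - simpl (2 * 0)%nat. destruct (Halt 0%nat). simpl in *. tauto.
    - replace (2 * S i)%nat with (S (S (2 * i))) by lia.
      destruct (Halt (S (2 * i))), (Halt (S (S (2 * i)))).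
      destruct IHi. split; intros B.
      + destruct (H3 B). auto.
      + destruct (H4 B). auto. }
  destruct (Hev m). replace (S (2 * m)) with n in * by lia. rewrite Hv in *.
  destruct (proj2 Hz 0%nat) as [[A _]|[A _]]; simpl in A.
  - specialize (H A). lra.
  - specialize (H0 A). lra.
Qed.

Lemma continuity_iter_upto g a c n : continuity g -> g a = a -> a < c ->
  exists e, e > 0 /\ forall i y, (i <= n)%nat -> a < y < a + e -> iter i g y < c.
Proof.
  intros Hc Ha Hac. induction n as [|n (e & He & Hn)].
  - exists (c - a). split; [lra|]. intros i y Hi Hy. replace i with 0%nat by lia. simpl. lra.
  - destruct (continuity_modulus (iter (S n) g) a (continuity_iter g (S n) Hc) (c - a))
      as (d & Hd & Hm); [lra|].
    rewrite iter_fix in Hm; auto.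
    exists (Rmin e d). split; [now apply Rmin_glb_lt|].
    intros i y Hi Hy. assert (Rmin e d <= e) by apply Rmin_l. assert (Rmin e d <= d) by apply Rmin_r.
    destruct (le_lt_dec i n) as [Hin|Hin]; [apply Hn; auto; lra|].
    replace i with (S n) by lia.
    assert (Hr : Rabs (y - a) < d) by (rewrite Rabs_right; lra).
    apply Hm, Rabs_def2 in Hr. lra.
Qed.

(* [g^n] has no fixed points but those of [g]. Just right of the last one below [c], [g] moves
   points up while [g^n] moves them down, which is absurd near a fixed point of [g]. *)
Lemma no_odd_return_below g c n : good g -> Nat.Odd n -> c < g c -> iter n g c <= c -> False.
Proof.
  intros Hg Hn Hc Hnc. assert (Hcont := proj1 Hg).
  assert (Hn1 : (1 <= n)%nat) by (destruct Hn; lia).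
  assert (Hlt : iter n g c < c).
  { destruct (Req_dec (iter n g c) c) as [E|]; [|lra].
    apply (odd_periodic_fixed g n c) in E; auto. lra. }
  destruct (last_fixpoint_below (iter n g) c (good_iter g n Hn1 Hg) Hlt) as (a & Hac & Ea & Hl).
  apply (odd_periodic_fixed g n a Hg Hn) in Ea.
  assert (Hup : forall y, a < y <= c -> y < g y).
  { intros y Hy. destruct (Rlt_le_dec y (g y)) as [|Hle]; auto. exfalso.
    destruct (ivt (fun x => g x - x) y c 0) as (t & Ht & Et); try lra.
    { now apply continuity_drift. }
    specialize (Hl t ltac:(lra)). rewrite iter_fix in Hl by lra. lra. }
  destruct (continuity_iter_upto g a c n Hcont Ea Hac) as (e & He & Hm).
  (* So close to the fixed point [a] that the first [n] steps stay below [c], where [g] moves points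
     up. *)
  set (y := a + Rmin e (c - a) / 2).
  assert (0 < Rmin e (c - a)) by (apply Rmin_glb_lt; lra).
  assert (Rmin e (c - a) <= e) by apply Rmin_l. assert (Rmin e (c - a) <= c - a) by apply Rmin_r.
  assert (Hi : forall i, (i <= n)%nat -> y <= iter i g y).
  { induction i; intros Hi; [simpl; lra|].
    specialize (IHi ltac:(lia)).
    assert (A := Hm i y ltac:(lia) ltac:(unfold y; lra)).
    assert (B := Hup (iter i g y) ltac:(unfold y in *; lra)). simpl. lra. }
  specialize (Hi n (le_n n)). specialize (Hl y ltac:(unfold y; lra)). lra.
Qed.

(** * Alternation and omega-limit sets *)

Lemma infinite_not_listed S l : infinite_set S -> (forall y, S y -> In y l) -> False.
Proof. intros H Hl. destruct (H l) as (y & Hy & Hn). auto. Qed.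

Lemma infinite_set_or_listed S : infinite_set S \/ exists l, forall y, S y -> In y l.
Proof.
  destruct (classic (infinite_set S)) as [|H]; auto. right.
  apply not_all_ex_not in H. destruct H as (l & Hl). exists l. intros y Hy.
  apply NNPP. intros Hn. apply Hl. eauto.
Qed.

Lemma omega_opp_conj g x y : omega g x y -> omega (opp_conj g) (- x) (- y).
Proof.
  intros H eps He N. destruct (H eps He N) as (n & Hn & Hd). exists n. split; auto.
  rewrite iter_opp_conj, Ropp_involutive.
  replace (- iter n g x - - y) with (- (iter n g x - y)) by ring. now rewrite Rabs_Ropp.
Qed.

Lemma infinite_omega_opp_conj g x : infinite_set (omega g x) -> infinite_set (omega (opp_conj g) (- x)).
Proof.
  intros H l. destruct (H (map Ropp l)) as (y & Hy & Hn). exists (- y). split.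
  - now apply omega_opp_conj.
  - intros Hin. apply Hn. rewrite <- (Ropp_involutive y). now apply in_map.
Qed.

Lemma Rabs_all_lt_eq a b : (forall eps, eps > 0 -> Rabs (a - b) < eps) -> a = b.
Proof.
  intros H. destruct (Req_dec a b) as [|Hn]; auto.
  specialize (H (Rabs (a - b))). assert (0 < Rabs (a - b)) by (apply Rabs_pos_lt; lra).
  specialize (H H0). lra.
Qed.

Lemma Rabs_tri3 a b c e1 e2 : Rabs (a - b) < e1 -> Rabs (a - c) < e2 -> Rabs (b - c) < e1 + e2.
Proof.
  intros H1 H2. apply Rabs_def2 in H1, H2. apply Rabs_def1; lra.
Qed.

(** The other half of the orbit consists of images of the first and tends to [g e]. This also serves
    for convergent and eventually fixed orbits. *)
Lemma half_convergent_omega g x e b : continuity g ->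
  (forall eps, eps > 0 -> exists N, forall n, (n >= N)%nat -> Nat.even n = b ->
     Rabs (iter n g x - e) < eps) ->
  forall y, omega g x y -> In y (e :: g e :: nil).
Proof.
  intros Hc Hb y Hy. apply NNPP. intros Hn. simpl in Hn.
  set (eps := Rmin (Rabs (y - e)) (Rabs (y - g e)) / 2).
  assert (H1 : 0 < Rabs (y - e)) by (apply Rabs_pos_lt; intros E; apply Hn; left; lra).
  assert (H2 : 0 < Rabs (y - g e)) by (apply Rabs_pos_lt; intros E; apply Hn; right; left; lra).
  assert (H3 := Rmin_l (Rabs (y - e)) (Rabs (y - g e))).
  assert (H4 := Rmin_r (Rabs (y - e)) (Rabs (y - g e))).
  assert (H5 : 0 < eps) by (unfold eps; assert (0 < Rmin (Rabs (y - e)) (Rabs (y - g e)))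
    by (now apply Rmin_glb_lt); lra).
  destruct (continuity_modulus g e Hc eps H5) as (d & Hd & Hm).
  destruct (Hb eps H5) as (N1 & HN1). destruct (Hb d Hd) as (N2 & HN2).
  destruct (Hy eps H5 (S (N1 + N2))) as (n & Hge & Hny).
  destruct (Bool.bool_dec (Nat.even n) b) as [Eb|Eb].
  - specialize (HN1 n ltac:(lia) Eb).
    assert (A := Rabs_tri3 _ _ _ _ _ Hny HN1). unfold eps in A. lra.
  - destruct n as [|n]; [lia|]. rewrite Nat.even_succ, <- Nat.negb_even in Eb.
    assert (Eb' : Nat.even n = b) by (destruct (Nat.even n), b; auto; exfalso; now apply Eb).
    specialize (HN2 n ltac:(lia) Eb'). apply Hm in HN2.
    assert (A := Rabs_tri3 _ _ _ _ _ Hny HN2). unfold eps in A. lra.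
Qed.

Definition left_often g x z b :=
  forall N, exists n, (n >= N)%nat /\ Nat.even n = b /\ iter n g x < z.

Definition right_often g x z b :=
  forall N, exists n, (n >= N)%nat /\ Nat.even n = b /\ z < iter n g x.

Lemma odd_difference n m : (n < m)%nat -> Nat.even m = negb (Nat.even n) -> Nat.Odd (m - n).
Proof.
  intros H1 H2. apply Nat.odd_spec. rewrite Nat.odd_sub by lia.
  rewrite <- !Nat.negb_even, H2. now destruct (Nat.even n).
Qed.

(* By [no_odd_return_below] a point left of [z] lies below all later points at times of the other
   parity. When both parities visit the left side infinitely often, left points of alternating parity
   therefore increase, and all left points are squeezed towards their supremum. *)
Lemma left_points_converge g x z : good g -> straddles g x z ->
  left_often g x z true -> left_often g x z false ->
  exists e, forall eps, eps > 0 -> exists N, forall n, (n >= N)%nat -> iter n g x < z ->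
    Rabs (iter n g x - e) < eps.
Proof.
  intros Hg Hs HE HO.
  assert (HL : forall b, left_often g x z b) by (intros []; auto).
  assert (Hlt : forall n m, (n < m)%nat -> Nat.even m = negb (Nat.even n) -> iter n g x < z ->
    iter n g x < iter m g x).
  { intros n m Hnm Hp Hz. destruct (Rlt_le_dec (iter n g x) (iter m g x)) as [|Hle]; auto.
    exfalso. apply (no_odd_return_below g (iter n g x) (m - n) Hg).
    - now apply odd_difference.
    - destruct (proj2 Hs n); simpl in *; lra.
    - rewrite <- iter_add. now replace (m - n + n)%nat with m by lia. }
  destruct (completeness (fun y => exists n, iter n g x < z /\ y = iter n g x)) as (e & Hub & Hlub).
  { exists z. intros y (n & Hn & ->). lra. }
  { destruct (HL true 0%nat) as (n & _ & _ & Hn). eauto. }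
  exists e. intros eps He.
  assert (Hex : exists n, iter n g x < z /\ e - eps < iter n g x).
  { apply NNPP. intros Hn. assert (e <= e - eps); [|lra]. apply Hlub. intros y (n & Hz & ->).
    apply Rnot_lt_le. intros Hlt'. apply Hn. eauto. }
  destruct Hex as (n & Hz & Hn).
  destruct (HL (negb (Nat.even n)) (S n)) as (m & Hm & Hp & Hmz).
  assert (Hnm := Hlt n m ltac:(lia) Hp Hz).
  exists (S m). intros k Hk Hkz. assert (iter k g x <= e) by (apply Hub; eauto).
  assert (e - eps < iter k g x).
  { destruct (Bool.bool_dec (Nat.even k) (negb (Nat.even n))) as [Ek|Ek].
    - specialize (Hlt n k ltac:(lia) Ek Hz). lra.
    - assert (Ek' : Nat.even k = negb (Nat.even m)).
      { rewrite Hp. destruct (Nat.even k), (Nat.even n); auto; exfalso; now apply Ek. }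
      specialize (Hlt m k ltac:(lia) Ek' Hmz). lra. }
  apply Rabs_def1; lra.
Qed.

Lemma often_opp_conj g x z b : left_often (opp_conj g) (- x) (- z) b <-> right_often g x z b.
Proof.
  unfold left_often, right_often. split; intros H N; destruct (H N) as (n & H1 & H2 & H3);
    exists n; repeat split; auto.
  - rewrite iter_opp_conj, Ropp_involutive in H3. lra.
  - rewrite iter_opp_conj, Ropp_involutive. lra.
Qed.

Lemma right_points_converge g x z : good g -> straddles g x z ->
  right_often g x z true -> right_often g x z false ->
  exists e, forall eps, eps > 0 -> exists N, forall n, (n >= N)%nat -> z < iter n g x ->
    Rabs (iter n g x - e) < eps.
Proof.
  intros Hg Hs HE HO.
  destruct (left_points_converge (opp_conj g) (- x) (- z)) as (e & He).
  - now apply good_opp_conj.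
  - now apply straddles_opp_conj.
  - now apply often_opp_conj.
  - now apply often_opp_conj.
  - exists (- e). intros eps Heps. destruct (He eps Heps) as (N & HN). exists N.
    intros n Hn Hz. specialize (HN n Hn). rewrite iter_opp_conj, Ropp_involutive in HN.
    specialize (HN ltac:(lra)). rewrite <- Rabs_Ropp.
    now replace (- (iter n g x - - e)) with (- iter n g x - e) by ring.
Qed.

Lemma not_right_often g x z b : straddles g x z -> ~ right_often g x z b ->
  exists N, forall n, (n >= N)%nat -> Nat.even n = b -> iter n g x < z.
Proof.
  intros Hs H. apply not_all_ex_not in H. destruct H as (N & HN). exists N.
  intros n Hn Hb. destruct (proj2 Hs n) as [|[A _]]; [tauto|]. exfalso. apply HN. eauto.
Qed.

Lemma not_left_often g x z b : straddles g x z -> ~ left_often g x z b ->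
  exists N, forall n, (n >= N)%nat -> Nat.even n = b -> z < iter n g x.
Proof.
  intros Hs H. apply not_all_ex_not in H. destruct H as (N & HN). exists N.
  intros n Hn Hb. destruct (proj2 Hs n) as [[A _]|]; [|tauto]. exfalso. apply HN. eauto.
Qed.

(** The left points converge. Either one parity is eventually always on the left, so that half of
    the orbit converges, or both parities also visit the right and the right points converge too; in
    each case at most two limit points remain. *)
Lemma left_often_one_parity g x z : good g -> straddles g x z -> infinite_set (omega g x) ->
  left_often g x z true -> left_often g x z false -> False.
Proof.
  intros Hg Hs Hinf HE HO.
  destruct (left_points_converge g x z Hg Hs HE HO) as (e & He).
  destruct (classic (exists b, ~ right_often g x z b)) as [(b & Hb)|Hb].
  - apply (infinite_not_listed _ (e :: g e :: nil) Hinf).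
    apply (half_convergent_omega g x e b (proj1 Hg)). intros eps Heps.
    destruct (not_right_often g x z b Hs Hb) as (N & HN).
    destruct (He eps Heps) as (N' & HN'). exists (N + N')%nat. intros n Hn Hpar.
    apply HN'; [lia|]. apply HN; auto; lia.
  - assert (Hr : forall b, right_often g x z b) by (intros b; apply NNPP; intros H; apply Hb; eauto).
    destruct (right_points_converge g x z Hg Hs (Hr true) (Hr false)) as (d & Hd).
    apply (infinite_not_listed _ (e :: d :: nil) Hinf). intros y Hy.
    apply NNPP. intros Hn. simpl in Hn.
    assert (H1 : 0 < Rabs (y - e)) by (apply Rabs_pos_lt; intros E; apply Hn; left; lra).
    assert (H2 : 0 < Rabs (y - d)) by (apply Rabs_pos_lt; intros E; apply Hn; right; left; lra).
    assert (H3 := Rmin_l (Rabs (y - e)) (Rabs (y - d))).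
    assert (H4 := Rmin_r (Rabs (y - e)) (Rabs (y - d))).
    assert (H5 : 0 < Rmin (Rabs (y - e)) (Rabs (y - d))) by (now apply Rmin_glb_lt).
    set (eps := Rmin (Rabs (y - e)) (Rabs (y - d)) / 2).
    assert (H6 : eps > 0) by (unfold eps; lra).
    destruct (He eps H6) as (N1 & HN1), (Hd eps H6) as (N2 & HN2).
    destruct (Hy eps H6 (N1 + N2)%nat) as (n & Hge & Hny).
    destruct (proj2 Hs n) as [[A _]|[A _]].
    + specialize (HN1 n ltac:(lia) A). assert (B := Rabs_tri3 _ _ _ _ _ Hny HN1).
      unfold eps in B. lra.
    + specialize (HN2 n ltac:(lia) A). assert (B := Rabs_tri3 _ _ _ _ _ Hny HN2).
      unfold eps in B. lra.
Qed.

Lemma right_often_one_parity g x z : good g -> straddles g x z -> infinite_set (omega g x) ->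
  right_often g x z true -> right_often g x z false -> False.
Proof.
  intros Hg Hs Hinf HE HO.
  apply (left_often_one_parity (opp_conj g) (- x) (- z)).
  - now apply good_opp_conj.
  - now apply straddles_opp_conj.
  - now apply infinite_omega_opp_conj.
  - now apply often_opp_conj.
  - now apply often_opp_conj.
Qed.

Lemma iter_bounded g M : (forall x, Rabs (g x) <= M) -> forall x n,
  Rabs (iter n g x) <= Rmax (Rabs x) M.
Proof.
  intros HM x n. destruct n; simpl; [apply Rmax_l|].
  eapply Rle_trans; [apply HM|apply Rmax_r].
Qed.

Lemma increasing_orbit_omega g x : good g -> (forall n, iter n g x <= iter (S n) g x) ->
  ~ infinite_set (omega g x).
Proof.
  intros Hg Hi Hinf. assert (Hb := proj1 (proj2 Hg)). destruct Hb as (M & HM).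
  destruct (growing_cv (fun n => iter n g x)) as (l & Hl).
  - exact Hi.
  - exists (Rmax (Rabs x) M). intros y (n & ->).
    assert (A := iter_bounded g M HM x n). apply Rabs_le_bounds in A. lra.
  - apply (infinite_not_listed _ (l :: g l :: nil) Hinf).
    apply (half_convergent_omega g x l true (proj1 Hg)). intros eps He.
    destruct (Hl eps He) as (N & HN). exists N. intros n Hn _. exact (HN n Hn).
Qed.

Lemma decreasing_orbit_omega g x : good g -> (forall n, iter (S n) g x <= iter n g x) ->
  ~ infinite_set (omega g x).
Proof.
  intros Hg Hi Hinf. apply (increasing_orbit_omega (opp_conj g) (- x)).
  - now apply good_opp_conj.
  - intros n. rewrite !iter_opp_conj, Ropp_involutive. specialize (Hi n). lra.
  - now apply infinite_omega_opp_conj.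
Qed.

Definition alternates (g : R -> R) (x z : R) (N : nat) : Prop :=
  forall n, (n >= N)%nat -> (iter n g x < z /\ z < iter (S n) g x) \/
                            (iter (S n) g x < z /\ z < iter n g x).

(** An infinite omega-limit set rules out monotone orbits and orbits landing on a fixed point, so a
    straddled [z] exists. Some parity is eventually only on the right; the other one cannot also be
    there infinitely often, so it ends up on the left. *)
Lemma infinite_omega_alternates g x : good g -> infinite_set (omega g x) ->
  exists z N, g z = z /\ alternates g x z N.
Proof.
  intros Hg Hinf.
  assert (Hnf : forall n, g (iter n g x) <> iter n g x).
  { intros n E. apply (infinite_not_listed _ (iter n g x :: g (iter n g x) :: nil) Hinf).
    apply (half_convergent_omega g x _ true (proj1 Hg)). intros eps He. exists n.
    intros m Hm _. replace m with (m - n + n)%nat by lia. rewrite iter_add, (iter_fix g); auto.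
    replace (iter n g x - iter n g x) with 0 by ring. rewrite Rabs_R0; auto. }
  destruct (exists_straddled g x Hg Hnf) as (z & Hs).
  { apply NNPP. intros Hn. apply (decreasing_orbit_omega g x Hg); auto. intros n.
    apply Rnot_lt_le. intros H; apply Hn; eauto. }
  { apply NNPP. intros Hn. apply (increasing_orbit_omega g x Hg); auto. intros n.
    apply Rnot_lt_le. intros H; apply Hn; eauto. }
  exists z.
  assert (Hlast : exists b N, forall n, (n >= N)%nat ->
    (Nat.even n = b -> z < iter n g x) /\ (Nat.even n = negb b -> iter n g x < z)).
  { assert (Hb : exists b, ~ left_often g x z b).
    { apply NNPP. intros Hn.
      assert (A : forall b, left_often g x z b) by (intros b; apply NNPP; intros H; apply Hn; eauto).
      exact (left_often_one_parity g x z Hg Hs Hinf (A true) (A false)). }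
    destruct Hb as (b & Hb). destruct (not_left_often g x z b Hs Hb) as (N & HN).
    assert (Hr : right_often g x z b).
    { intros K. destruct (Bool.bool_dec (Nat.even (N + K)) b) as [E|E].
      - exists (N + K)%nat. split; [lia|]. split; auto. apply HN; auto; lia.
      - exists (S (N + K)). assert (Nat.even (S (N + K)) = b).
        { rewrite Nat.even_succ, <- Nat.negb_even. destruct (Nat.even (N + K)), b; auto;
            exfalso; now apply E. }
        split; [lia|]. split; auto. apply HN; auto; lia. }
    assert (Hr' : ~ right_often g x z (negb b)).
    { intros H. destruct b; simpl in H.
      - exact (right_often_one_parity g x z Hg Hs Hinf Hr H).
      - exact (right_often_one_parity g x z Hg Hs Hinf H Hr). }
    destruct (not_right_often g x z _ Hs Hr') as (N' & HN').
    exists b, (N + N')%nat. intros n Hn. split; intros E.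
    - apply HN; auto; lia.
    - apply HN'; auto; lia. }
  destruct Hlast as (b & N & HN). exists N. split; [apply Hs|]. intros n Hn.
  destruct (HN n Hn) as [A1 A2]. destruct (HN (S n) ltac:(lia)) as [B1 B2].
  rewrite Nat.even_succ, <- Nat.negb_even in B1, B2.
  destruct (Nat.even n), b; simpl in *; auto.
Qed.

(** The omega-limit set of [iter i f x] under [f^r], expressed through times of the original orbit;
    only the residue of [i] matters, so classes for different moduli can be compared. *)
Definition omega_mod (f : R -> R) (x : R) (r i : nat) (y : R) : Prop :=
  forall eps, eps > 0 -> forall N, exists n, (n >= N)%nat /\ (n mod r = i mod r)%nat /\
    Rabs (iter n f x - y) < eps.

Lemma mod_eq_add n i r : (1 <= r)%nat -> (i <= n)%nat -> (n mod r = i mod r)%nat ->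
  exists q, n = (q * r + i)%nat.
Proof.
  intros Hr Hin H. exists (n / r - i / r)%nat.
  assert (A := Nat.div_mod_eq n r). assert (B := Nat.div_mod_eq i r).
  assert (i / r <= n / r)%nat by (apply Nat.Div0.div_le_mono; lia). nia.
Qed.

Lemma mod_add_mult i q r : ((q * r + i) mod r = i mod r)%nat.
Proof. rewrite Nat.add_comm. apply Nat.Div0.mod_add. Qed.

Lemma omega_iter_iff f x r i y : (1 <= r)%nat ->
  omega (iter r f) (iter i f x) y <-> omega_mod f x r i y.
Proof.
  intros Hr. split; intros H eps He N.
  - destruct (H eps He N) as (n & Hn & Hd). rewrite iter_mul, <- iter_add in Hd.
    exists (n * r + i)%nat. split; [nia|]. split; auto. apply mod_add_mult.
  - destruct (H eps He (N * r + i)%nat) as (n & Hn & Hm & Hd).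
    destruct (mod_eq_add n i r Hr ltac:(lia) Hm) as (q & ->).
    exists q. split; [nia|]. now rewrite iter_mul, <- iter_add.
Qed.

Lemma omega_mod_omega f x r i y : omega_mod f x r i y -> omega f x y.
Proof. intros H eps He N. destruct (H eps He N) as (n & Hn & _ & Hd). eauto. Qed.

(** Pigeonhole over the residue classes. The sequence is arbitrary because it is used both for
    distances to a limit point and for distances between two orbits. *)
Lemma small_in_some_residue (d : nat -> R) r : (1 <= r)%nat ->
  (forall eps, eps > 0 -> forall N, exists n, (n >= N)%nat /\ Rabs (d n) < eps) ->
  exists j, (j < r)%nat /\ forall eps, eps > 0 -> forall N,
    exists n, (n >= N)%nat /\ (n mod r = j mod r)%nat /\ Rabs (d n) < eps.
Proof.
  intros Hr Hd. apply NNPP. intros Hn.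
  assert (A : forall k, (k <= r)%nat -> exists eps N, eps > 0 /\
    forall n, (n >= N)%nat -> (n mod r < k)%nat -> eps <= Rabs (d n)).
  { induction k as [|k IH]; intros Hk.
    - exists 1, 0%nat. split; [lra|]. intros; lia.
    - destruct IH as (e1 & N1 & He1 & H1); [lia|].
      assert (B : ~ forall eps, eps > 0 -> forall N,
        exists n, (n >= N)%nat /\ (n mod r = k mod r)%nat /\ Rabs (d n) < eps)
        by (intros H; apply Hn; exists k; split; auto; lia).
      apply not_all_ex_not in B. destruct B as (e2 & B). apply imply_to_and in B.
      destruct B as (He2 & B). apply not_all_ex_not in B. destruct B as (N2 & B).
      exists (Rmin e1 e2), (N1 + N2)%nat. split; [now apply Rmin_glb_lt|].
      intros n Hge Hlt. assert (C1 := Rmin_l e1 e2). assert (C2 := Rmin_r e1 e2).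
      destruct (Nat.eq_dec (n mod r) k) as [E|E].
      + apply Rnot_lt_le. intros C. apply B. exists n. split; [lia|]. split; [|lra].
        rewrite E. symmetry. apply Nat.mod_small. lia.
      + eapply Rle_trans; [apply C1|]. apply H1; lia. }
  destruct (A r (le_n r)) as (e & N & He & H). destruct (Hd e He N) as (n & Hge & Hsm).
  specialize (H n Hge ltac:(apply Nat.mod_upper_bound; lia)). lra.
Qed.

Lemma omega_some_residue f x r y : (1 <= r)%nat -> omega f x y ->
  exists j, (j < r)%nat /\ omega_mod f x r j y.
Proof. intros Hr Hy. exact (small_in_some_residue (fun n => iter n f x - y) r Hr Hy). Qed.

Lemma bounded_adherent (u : nat -> R) M : (forall n, Rabs (u n) <= M) ->
  exists l, forall eps, eps > 0 -> forall N, exists n, (n >= N)%nat /\ Rabs (u n - l) < eps.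
Proof.
  intros H. destruct (Bolzano_Weierstrass u (fun c => - M <= c <= M)) as (l & Hl).
  - apply compact_P3.
  - intros n. now apply Rabs_le_bounds.
  - exists l. intros eps He N. destruct (Hl (disc l (mkposreal eps He)) N) as (p & Hp & Hd).
    + exists (mkposreal eps He). intros y Hy; exact Hy.
    + exists p. split; [lia|exact Hd].
Qed.

Lemma inv_INR_lt eps : eps > 0 -> exists N, forall n, (n >= N)%nat -> / (INR n + 1) < eps.
Proof.
  intros He. destruct (archimed_cor1 eps He) as (N & HN & HN0). exists N. intros n Hn.
  eapply Rle_lt_trans; [|exact HN]. apply Rinv_le_contravar.
  - now apply lt_0_INR.
  - assert (A := le_INR N n Hn). lra.
Qed.

(** Take late times in class [i] whose orbit points, [j] steps later, tend to [y]; any adherent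
    point of the orbit along these times is a preimage. *)
Lemma omega_mod_preimage f x r i j y : good f -> (1 <= r)%nat -> omega_mod f x r (i + j) y ->
  exists w, omega_mod f x r i w /\ iter j f w = y.
Proof.
  intros Hg Hr Hy. destruct (proj1 (proj2 Hg)) as (M & HM).
  assert (Hch : forall k, exists n, (n >= k)%nat /\ (n mod r = i mod r)%nat /\
    Rabs (iter (n + j) f x - y) < / (INR k + 1)).
  { intros k. assert (Hk : / (INR k + 1) > 0) by (apply Rinv_0_lt_compat; assert (A := pos_INR k); lra).
    destruct (Hy _ Hk (k + i + j)%nat) as (n & Hn & Hm & Hd).
    destruct (mod_eq_add n (i + j) r Hr ltac:(lia) Hm) as (q & ->).
    exists (q * r + i)%nat. split; [lia|]. split; [apply mod_add_mult|].
    now replace (q * r + i + j)%nat with (q * r + (i + j))%nat by lia. }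
  apply choice in Hch. destruct Hch as (n & Hn).
  destruct (bounded_adherent (fun k => iter (n k) f x) (Rmax (Rabs x) M)) as (w & Hw).
  { intros k. now apply iter_bounded. }
  exists w. split.
  - intros eps He N. destruct (Hw eps He N) as (k & Hk & Hd). destruct (Hn k) as (A & B & _).
    exists (n k). split; [lia|]. auto.
  - apply Rabs_all_lt_eq. intros eps He.
    destruct (continuity_modulus (iter j f) w (continuity_iter f j (proj1 Hg)) (eps / 2))
      as (d & Hd & Hm); [lra|].
    destruct (inv_INR_lt (eps / 2)) as (N & HN); [lra|].
    destruct (Hw d Hd N) as (k & Hk & Hkd). destruct (Hn k) as (_ & _ & C).
    specialize (HN k Hk). apply Hm in Hkd. rewrite <- iter_add, Nat.add_comm in Hkd.
    assert (C' : Rabs (iter (n k + j) f x - y) < eps / 2) by lra.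
    assert (D := Rabs_tri3 _ _ _ _ _ Hkd C'). lra.
Qed.

Lemma omega_mod_image f x r i j y : continuity f -> omega_mod f x r i y ->
  omega_mod f x r (i + j) (iter j f y).
Proof.
  intros Hc H eps He N.
  destruct (continuity_modulus (iter j f) y (continuity_iter f j Hc) eps He) as (d & Hd & Hm).
  destruct (H d Hd N) as (n & Hn & Hr & Hy). exists (j + n)%nat. split; [lia|]. split.
  - rewrite Nat.Div0.add_mod, Hr, <- Nat.Div0.add_mod. f_equal; lia.
  - rewrite iter_add. auto.
Qed.

(** The whole omega-limit set is a union of finitely many images of the limit set of a single
    class. *)
Lemma infinite_omega_iter f x r i : good f -> (1 <= r)%nat -> infinite_set (omega f x) ->
  infinite_set (omega (iter r f) (iter i f x)).
Proof.
  intros Hg Hr Hinf. destruct (infinite_set_or_listed (omega (iter r f) (iter i f x))) as [|(l & Hl)];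
    auto. exfalso.
  (* Class [j] is reached from class [i] in [j + r * i - i] steps; the term [r * i] prevents
     truncated subtraction. *)
  apply (infinite_not_listed _ (flat_map (fun j => map (iter j f) l) (seq 0 (r + r * i))) Hinf).
  intros y Hy. destruct (omega_some_residue f x r y Hr Hy) as (j & Hj & Hjy).
  destruct (omega_mod_preimage f x r i (j + r * i - i) y Hg Hr) as (w & Hw & Ew).
  { replace (i + (j + r * i - i))%nat with (i * r + j)%nat by nia.
    intros eps He N. destruct (Hjy eps He N) as (n & A & B & C). exists n. split; auto. split; auto.
    now rewrite mod_add_mult. }
  apply in_flat_map. exists (j + r * i - i)%nat. split.
  - apply in_seq. nia.
  - apply in_map_iff. exists w. split; auto. apply Hl. now apply omega_iter_iff.
Qed.

(* Both [g] and [g^2] alternate around fixed points, and each of these must be [c]; but if [g]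
   alternates around [c], then [g^2] stays on one side of it. *)
Lemma infinite_omega_no_fixpoint g x c : good g -> infinite_set (omega g x) -> g c = c ->
  ~ omega g x c.
Proof.
  intros Hg Hinf Hc Hom.
  destruct (infinite_omega_alternates g x Hg Hinf) as (z & N & Ez & HN).
  destruct (infinite_omega_alternates (iter 2 g) x) as (z2 & N2 & _ & HN2).
  { apply good_iter; auto. }
  { apply (infinite_omega_iter g x 2 0 Hg); auto. }
  (* Three steps suffice for two consecutive points of the orbit of [g^2], after at most one step to
     an even time. *)
  assert (Hnear : forall eps, eps > 0 -> forall K, exists n, (n >= K)%nat /\
    forall k, (k <= 3)%nat -> Rabs (iter (k + n) g x - c) < eps).
  { intros eps He K.
    assert (Hk : forall k, exists d, d > 0 /\ forall y, Rabs (y - c) < d -> Rabs (iter k g y - c) < eps).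
    { intros k. destruct (continuity_modulus (iter k g) c (continuity_iter g k (proj1 Hg)) eps He)
        as (d & Hd & Hm). rewrite iter_fix in Hm; auto. eauto. }
    destruct (Hk 0%nat) as (d0 & D0 & M0), (Hk 1%nat) as (d1 & D1 & M1),
      (Hk 2%nat) as (d2 & D2 & M2), (Hk 3%nat) as (d3 & D3 & M3).
    destruct (Hom (Rmin (Rmin d0 d1) (Rmin d2 d3))) with (N := K) as (n & Hn & Hd).
    { repeat apply Rmin_glb_lt; auto. }
    assert (A1 := Rmin_l (Rmin d0 d1) (Rmin d2 d3)). assert (A2 := Rmin_r (Rmin d0 d1) (Rmin d2 d3)).
    assert (A3 := Rmin_l d0 d1). assert (A4 := Rmin_r d0 d1).
    assert (A5 := Rmin_l d2 d3). assert (A6 := Rmin_r d2 d3).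
    exists n. split; auto. intros k Hk3. rewrite iter_add.
    destruct k as [|[|[|[|]]]]; [apply M0|apply M1|apply M2|apply M3|]; try lra. lia. }
  assert (E1 : z = c).
  { apply Rabs_all_lt_eq. intros eps He. destruct (Hnear eps He N) as (n & Hn & Hd).
    assert (B0 := Hd 0%nat ltac:(lia)). assert (B1 := Hd 1%nat ltac:(lia)).
    apply Rabs_def2 in B0, B1. specialize (HN n Hn). simpl in *. apply Rabs_def1; lra. }
  assert (E2 : z2 = c).
  { apply Rabs_all_lt_eq. intros eps He. destruct (Hnear eps He (2 * N2)%nat) as (n & Hn & Hd).
    assert (Hm : exists m k, (n + k = m * 2)%nat /\ (k <= 1)%nat).
    { destruct (Nat.Even_or_Odd n) as [(m & E)|(m & E)].
      - exists m, 0%nat. lia.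
      - exists (S m), 1%nat. lia. }
    destruct Hm as (m & k & Em & Hk).
    assert (B0 := Hd k ltac:(lia)). assert (B1 := Hd (2 + k)%nat ltac:(lia)).
    specialize (HN2 m ltac:(lia)). rewrite !iter_mul in HN2.
    replace (m * 2)%nat with (k + n)%nat in HN2 by lia.
    replace (S m * 2)%nat with (2 + k + n)%nat in HN2 by lia.
    apply Rabs_def2 in B0, B1. apply Rabs_def1; lra. }
  subst z z2.
  set (m := (N + N2)%nat).
  specialize (HN2 m ltac:(lia)). rewrite !iter_mul in HN2.
  assert (C1 := HN (m * 2)%nat ltac:(lia)). assert (C2 := HN (S (m * 2)) ltac:(lia)).
  replace (S m * 2)%nat with (S (S (m * 2))) in HN2 by lia. lra.
Qed.

(** * From scrambled pairs to nonseparable pairs *)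

Lemma omega_mod_1 f x y : omega_mod f x 1 0 y <-> omega f x y.
Proof.
  split; [apply omega_mod_omega|]. intros H eps He N. destruct (H eps He N) as (n & Hn & Hd).
  exists n. rewrite !Nat.mod_1_r. auto.
Qed.

Lemma omega_mod_congr f x r i j y : (i mod r = j mod r)%nat ->
  omega_mod f x r i y -> omega_mod f x r j y.
Proof.
  intros E H eps He N. destruct (H eps He N) as (n & A & B & C). exists n. rewrite <- E. auto.
Qed.

Lemma omega_mod_subsequence f x r i (Q : nat -> Prop) : good f ->
  (forall N, exists n, (n >= N)%nat /\ (n mod r = i mod r)%nat /\ Q n) ->
  exists w, omega_mod f x r i w /\ forall eps, eps > 0 -> exists n, Q n /\ Rabs (iter n f x - w) < eps.
Proof.
  intros Hg H. destruct (proj1 (proj2 Hg)) as (M & HM).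
  apply choice in H. destruct H as (n & Hn).
  destruct (bounded_adherent (fun k => iter (n k) f x) (Rmax (Rabs x) M)) as (w & Hw).
  { intros k. now apply iter_bounded. }
  exists w. split.
  - intros eps He N. destruct (Hw eps He N) as (k & Hk & Hd). destruct (Hn k) as (A & B & _).
    exists (n k). split; [lia|]. auto.
  - intros eps He. destruct (Hw eps He 0%nat) as (k & Hk & Hd). exists (n k).
    split; auto. apply Hn.
Qed.

Lemma residue_unbounded r i N : (1 <= r)%nat -> exists n, (n >= N)%nat /\ (n mod r = i mod r)%nat.
Proof. intros Hr. exists (N * r + i)%nat. split; [nia|apply mod_add_mult]. Qed.

Lemma closed_bounded_max S M : (exists y, S y) -> (forall y, S y -> y <= M) ->
  (forall y, (forall eps, eps > 0 -> exists z, S z /\ Rabs (z - y) < eps) -> S y) ->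
  exists m, is_max S m.
Proof.
  intros Hne HM Hcl. destruct (completeness S) as (m & Hub & Hlub).
  - exists M. exact HM.
  - exact Hne.
  - exists m. split; [|exact Hub]. apply Hcl. intros eps He. apply NNPP. intros Hn.
    assert (m <= m - eps); [|lra]. apply Hlub. intros y Hy. apply Rnot_lt_le. intros Hlt.
    apply Hn. exists y. split; auto. specialize (Hub y Hy). apply Rabs_def1; lra.
Qed.

Lemma closed_bounded_min S M : (exists y, S y) -> (forall y, S y -> M <= y) ->
  (forall y, (forall eps, eps > 0 -> exists z, S z /\ Rabs (z - y) < eps) -> S y) ->
  exists m, is_min S m.
Proof.
  intros (y0 & Hy0) HM Hcl. destruct (closed_bounded_max (fun y => S (- y)) (- M)) as (m & Hm1 & Hm2).
  - exists (- y0). now rewrite Ropp_involutive.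
  - intros y Hy. specialize (HM _ Hy). lra.
  - intros y Hy. apply Hcl. intros eps He. destruct (Hy eps He) as (z & Hz & Hd).
    exists (- z). split; auto. replace (- z - - y) with (- (z - y)) by ring. now rewrite Rabs_Ropp.
  - exists (- m). split; auto. intros y Hy. specialize (Hm2 (- y)).
    rewrite Ropp_involutive in Hm2. specialize (Hm2 Hy). lra.
Qed.

Lemma omega_mod_closed f x r i y :
  (forall eps, eps > 0 -> exists z, omega_mod f x r i z /\ Rabs (z - y) < eps) -> omega_mod f x r i y.
Proof.
  intros H eps He N. destruct (H (eps / 2)) as (z & Hz & Hd); [lra|].
  destruct (Hz (eps / 2) ltac:(lra) N) as (n & Hn & Hm & Hd'). exists n. split; auto. split; auto.
  rewrite Rabs_minus_sym in Hd'. assert (A := Rabs_tri3 _ _ _ _ _ Hd' Hd). lra.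
Qed.

Lemma omega_bounded f x : good f -> exists C, forall z, omega f x z -> Rabs z <= C.
Proof.
  intros Hg. destruct (proj1 (proj2 Hg)) as (M & HM). exists (Rmax (Rabs x) M + 1).
  intros z Hz. destruct (Hz 1 ltac:(lra) 0%nat) as (n & _ & Hd).
  assert (A := iter_bounded f M HM x n). apply Rabs_le_bounds in A. apply Rabs_def2 in Hd.
  apply Rabs_le. lra.
Qed.

Lemma omega_mod_extrema f x r i : good f -> (1 <= r)%nat ->
  exists a b, is_min (omega_mod f x r i) a /\ is_max (omega_mod f x r i) b.
Proof.
  intros Hg Hr.
  destruct (omega_mod_subsequence f x r i (fun _ => True) Hg) as (w & Hw & _).
  { intros N. destruct (residue_unbounded r i N Hr) as (n & A & B). exists n. auto. }
  destruct (omega_bounded f x Hg) as (C & HC).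
  assert (HC' : forall y, omega_mod f x r i y -> - C <= y <= C).
  { intros y Hy. apply Rabs_le_bounds, HC. now apply omega_mod_omega in Hy. }
  destruct (closed_bounded_min (omega_mod f x r i) (- C)) as (a & Ha); eauto.
  { intros y Hy. now apply HC'. }
  { intros y. apply omega_mod_closed. }
  destruct (closed_bounded_max (omega_mod f x r i) C) as (b & Hb); eauto.
  { intros y Hy. now apply HC'. }
  { intros y. apply omega_mod_closed. }
Qed.

Lemma omega_mod_eventually_near f x r i eps : good f -> eps > 0 ->
  exists N, forall n, (n >= N)%nat -> (n mod r = i mod r)%nat ->
    exists y, omega_mod f x r i y /\ Rabs (iter n f x - y) < eps.
Proof.
  intros Hg He. apply NNPP. intros Hn.
  destruct (omega_mod_subsequence f x r i
    (fun n => ~ exists y, omega_mod f x r i y /\ Rabs (iter n f x - y) < eps) Hg) as (w & Hw & Hd).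
  - intros N. apply NNPP. intros HN. apply Hn. exists N. intros n Hge Hm.
    apply NNPP. intros H. apply HN. eauto.
  - destruct (Hd eps He) as (n & Hq & Hlt). apply Hq. eauto.
Qed.

Lemma list_separated (l : list R) : exists eta, eta > 0 /\
  forall a b, In a l -> In b l -> Rabs (a - b) < eta -> a = b.
Proof.
  assert (Hfar : forall c (l : list R), exists eta, eta > 0 /\
    forall a, In a l -> Rabs (a - c) < eta -> a = c).
  { intros c l'. induction l' as [|a l' (e & He & H)].
    - exists 1. split; [lra|]. intros a [].
    - destruct (Req_dec a c) as [E|E].
      + exists e. split; auto. intros a' [<-|Hin] Hd; auto.
      + exists (Rmin e (Rabs (a - c))). split.
        { apply Rmin_glb_lt; auto. apply Rabs_pos_lt. lra. }
        assert (A1 := Rmin_l e (Rabs (a - c))). assert (A2 := Rmin_r e (Rabs (a - c))).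
        intros a' [<-|Hin] Hd; [lra|]. apply H; auto. lra. }
  induction l as [|c l (e & He & H)].
  - exists 1. split; [lra|]. intros a b [].
  - destruct (Hfar c l) as (e' & He' & H').
    exists (Rmin e e'). split; [now apply Rmin_glb_lt|].
    assert (A1 := Rmin_l e e'). assert (A2 := Rmin_r e e').
    intros a b [<-|Ha] [<-|Hb] Hd; auto.
    + symmetry. apply H'; auto. rewrite Rabs_minus_sym. lra.
    + apply H'; auto. lra.
    + apply H; auto. lra.
Qed.

Lemma list_modulus f (l : list R) eps : continuity f -> eps > 0 ->
  exists d, d > 0 /\ forall a y, In a l -> Rabs (y - a) < d -> Rabs (f y - f a) < eps.
Proof.
  intros Hc He. induction l as [|a l (d & Hd & H)].
  - exists 1. split; [lra|]. intros a y [].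
  - destruct (continuity_modulus f a Hc eps He) as (d' & Hd' & H').
    exists (Rmin d d'). split; [now apply Rmin_glb_lt|].
    assert (A1 := Rmin_l d d'). assert (A2 := Rmin_r d d').
    intros a' y [<-|Hin] Hy; [apply H'; lra|apply H; auto; lra].
Qed.

(** The limit points are [eta] apart. A late orbit point is near one of them, its image is near the
    image of that one by continuity, and no other limit point is close enough; so the nearby limit
    points form an orbit. *)
Lemma finite_omega_tracked f x l : good f -> (forall y, omega f x y -> In y l) ->
  exists w N, (forall k, In (iter k f w) l) /\
    forall eps, eps > 0 -> exists K, forall k, (k >= K)%nat ->
      Rabs (iter (N + k) f x - iter k f w) < eps.
Proof.
  intros Hg Hl. destruct (list_separated l) as (eta & Heta & Hsep).
  destruct (list_modulus f l (eta / 4) (proj1 Hg)) as (d & Hd & Hm); [lra|].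
  assert (Hnear : forall eps, eps > 0 -> exists N, forall n, (n >= N)%nat ->
    exists y, omega f x y /\ Rabs (iter n f x - y) < eps).
  { intros eps He. destruct (omega_mod_eventually_near f x 1 0 eps Hg He) as (N & HN).
    exists N. intros n Hn. destruct (HN n Hn) as (y & Hy & Hyd); [now rewrite !Nat.mod_1_r|].
    exists y. split; auto. now apply omega_mod_1. }
  set (e1 := Rmin d (eta / 4)).
  assert (A1 : e1 <= d) by apply Rmin_l. assert (A2 : e1 <= eta / 4) by apply Rmin_r.
  assert (He1 : e1 > 0) by (apply Rmin_glb_lt; lra).
  destruct (Hnear e1 He1) as (N & HN).
  destruct (HN N ltac:(lia)) as (w & Hw & Hwd).
  assert (Htrack : forall k, omega f x (iter k f w) /\ Rabs (iter (N + k) f x - iter k f w) < e1).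
  { induction k as [|k (IH1 & IH2)].
    - rewrite Nat.add_0_r. auto.
    - assert (Hom : omega f x (iter (S k) f w)).
      { apply omega_mod_1. apply omega_mod_1 in IH1.
        apply (omega_mod_image f x 1 0 1 _ (proj1 Hg)) in IH1.
        apply (omega_mod_congr f x 1 (0 + 1) 0); auto. }
      split; auto. destruct (HN (N + S k)%nat ltac:(lia)) as (y & Hy & Hyd).
      assert (B := Hm (iter k f w) (iter (N + k) f x) (Hl _ IH1) ltac:(lra)).
      change (f (iter (N + k) f x)) with (iter (S (N + k)) f x) in B.
      replace (S (N + k)) with (N + S k)%nat in B by lia.
      assert (C := Rabs_tri3 _ _ _ _ _ Hyd B).
      assert (E : y = iter (S k) f w) by (apply Hsep; auto; simpl; lra).
      now rewrite <- E. }
  exists w, N. split; [intros k; now apply Hl, Htrack|].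
  intros eps He. destruct (Hnear (Rmin eps e1)) as (K & HK); [now apply Rmin_glb_lt|].
  assert (A3 := Rmin_l eps e1). assert (A4 := Rmin_r eps e1).
  exists K. intros k Hk. destruct (HK (N + k)%nat ltac:(lia)) as (y & Hy & Hyd).
  destruct (Htrack k) as (B1 & B2). assert (C := Rabs_tri3 _ _ _ _ _ Hyd B2).
  assert (E : y = iter k f w) by (apply Hsep; auto; lra).
  rewrite <- E. lra.
Qed.

(** Both orbits shadow orbits in finite sets. At a late time of closeness the two shadows coincide,
    and they do so ever after. *)
Lemma proximal_finite_asymptotic f x y l l' : good f -> proximal f x y ->
  (forall z, omega f x z -> In z l) -> (forall z, omega f y z -> In z l') -> asymptotic f x y.
Proof.
  intros Hg Hp Hl Hl'.
  destruct (finite_omega_tracked f x l Hg Hl) as (w & N & Hw & Htw).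
  destruct (finite_omega_tracked f y l' Hg Hl') as (w' & N' & Hw' & Htw').
  destruct (list_separated (l ++ l')) as (eta & Heta & Hsep).
  destruct (Htw (eta / 4)) as (K & HK); [lra|]. destruct (Htw' (eta / 4)) as (K' & HK'); [lra|].
  destruct (Hp (eta / 4) ltac:(lra) (N + N' + K + K')%nat) as (n & Hn & Hd).
  assert (E : iter (n - N) f w = iter (n - N') f w').
  { apply Hsep; [apply in_or_app; auto|apply in_or_app; auto|].
    specialize (HK (n - N)%nat ltac:(lia)). specialize (HK' (n - N')%nat ltac:(lia)).
    replace (N + (n - N))%nat with n in HK by lia. replace (N' + (n - N'))%nat with n in HK' by lia.
    assert (A := Rabs_tri3 _ _ _ _ _ Hd HK).
    assert (B := Rabs_tri3 _ _ _ _ _ A HK'). lra. }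
  intros eps He. destruct (Htw (eps / 2)) as (J & HJ); [lra|].
  destruct (Htw' (eps / 2)) as (J' & HJ'); [lra|].
  exists (n + J + J' + N + N')%nat. intros m Hm.
  specialize (HJ (m - N)%nat ltac:(lia)). specialize (HJ' (m - N')%nat ltac:(lia)).
  replace (N + (m - N))%nat with m in HJ by lia. replace (N' + (m - N'))%nat with m in HJ' by lia.
  replace (m - N)%nat with (m - n + (n - N))%nat in HJ by lia.
  replace (m - N')%nat with (m - n + (n - N'))%nat in HJ' by lia.
  rewrite iter_add, E, <- iter_add in HJ. rewrite iter_add, <- iter_add in HJ'.
  rewrite Rabs_minus_sym in HJ, HJ'.
  assert (A := Rabs_tri3 _ _ _ _ _ HJ HJ'). lra.
Qed.

Lemma finite_orbit_periodic (f : R -> R) c l : (forall k, In (iter k f c) l) ->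
  exists i r, (1 <= r)%nat /\ iter r f (iter i f c) = iter i f c.
Proof.
  intros Hl. apply NNPP. intros Hn.
  assert (Hinj : Injective (fun k => iter k f c)).
  { assert (H : forall i j, (i < j)%nat -> iter i f c = iter j f c -> False).
    { intros i j Hij E. apply Hn. exists i, (j - i)%nat. split; [lia|].
      rewrite <- iter_add, E. f_equal. lia. }
    intros i j E. destruct (Nat.lt_total i j) as [A|[A|A]]; auto; exfalso; eauto. }
  assert (A := Injective_map_NoDup Hinj (seq_NoDup (S (length l)) 0)).
  assert (B : incl (map (fun k => iter k f c) (seq 0 (S (length l)))) l).
  { intros y Hy. apply in_map_iff in Hy. destruct Hy as (k & <- & _). auto. }
  apply (NoDup_incl_length A) in B. rewrite length_map, length_seq in B. lia.
Qed.

Lemma infinite_omega_no_periodic f x c r : good f -> infinite_set (omega f x) ->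
  (1 <= r)%nat -> iter r f c = c -> ~ omega f x c.
Proof.
  intros Hg Hinf Hr Hc Hom. destruct (omega_some_residue f x r c Hr Hom) as (j & _ & Hj).
  apply (infinite_omega_no_fixpoint (iter r f) (iter j f x) c); auto.
  - now apply good_iter.
  - now apply infinite_omega_iter.
  - now apply omega_iter_iff.
Qed.

(** The orbit of [y] shadows one inside [l], while that of [x] keeps away from the points of [l]
    outside its limit set. At a late time of closeness the shadow lies in [omega f x], and so does
    the periodic point into which it runs, which is excluded. *)
Lemma proximal_not_mixed f x y l : good f -> proximal f x y -> infinite_set (omega f x) ->
  (forall z, omega f y z -> In z l) -> False.
Proof.
  intros Hg Hp Hinf Hl.
  destruct (finite_omega_tracked f y l Hg Hl) as (w & N & Hw & Htw).
  assert (Hout : exists eps K, eps > 0 /\ forall a, In a l -> ~ omega f x a ->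
    forall n, (n >= K)%nat -> eps <= Rabs (iter n f x - a)).
  { clear Hl Hw. induction l as [|a l (e & K & He & H)].
    - exists 1, 0%nat. split; [lra|]. intros a [].
    - destruct (classic (omega f x a)) as [Ho|Ho].
      + exists e, K. split; auto. intros a' [<-|Hin] Hno; [contradiction|auto].
      + apply not_all_ex_not in Ho. destruct Ho as (e' & Ho). apply imply_to_and in Ho.
        destruct Ho as (He' & Ho). apply not_all_ex_not in Ho. destruct Ho as (K' & Ho).
        exists (Rmin e e'), (K + K')%nat. split; [now apply Rmin_glb_lt|].
        assert (A1 := Rmin_l e e'). assert (A2 := Rmin_r e e').
        intros a' [<-|Hin] Hno n Hn.
        * apply Rnot_lt_le. intros Hlt. apply Ho. exists n. split; [lia|lra].
        * eapply Rle_trans; [apply A1|]. apply H; auto. lia. }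
  destruct Hout as (e & K & He & Hout).
  destruct (Htw (e / 2)) as (J & HJ); [lra|].
  destruct (Hp (e / 2) ltac:(lra) (N + J + K)%nat) as (n & Hn & Hd).
  specialize (HJ (n - N)%nat ltac:(lia)). replace (N + (n - N))%nat with n in HJ by lia.
  rewrite Rabs_minus_sym in Hd. assert (A := Rabs_tri3 _ _ _ _ _ Hd HJ).
  assert (Hom : omega f x (iter (n - N) f w)).
  { apply NNPP. intros Hno. specialize (Hout _ (Hw (n - N)%nat) Hno n ltac:(lia)). lra. }
  destruct (finite_orbit_periodic f (iter (n - N) f w) l) as (i & r & Hr & E).
  { intros k. rewrite <- iter_add. auto. }
  apply (infinite_omega_no_periodic f x (iter i f (iter (n - N) f w)) r Hg Hinf Hr E).
  apply omega_mod_1 in Hom. apply (omega_mod_image f x 1 0 i _ (proj1 Hg)) in Hom.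
  now apply omega_mod_omega in Hom.
Qed.

Lemma proximal_sym f x y : proximal f x y -> proximal f y x.
Proof.
  intros H eps He N. destruct (H eps He N) as (n & A & B). exists n. now rewrite Rabs_minus_sym.
Qed.

Lemma scrambled_infinite_omega f x y : good f -> scrambled_pair f x y ->
  infinite_set (omega f x) /\ infinite_set (omega f y).
Proof.
  intros Hg (Hp & Ha).
  destruct (infinite_set_or_listed (omega f x)) as [Hx|(l & Hx)],
    (infinite_set_or_listed (omega f y)) as [Hy|(l' & Hy)]; auto; exfalso.
  - exact (proximal_not_mixed f x y l' Hg Hp Hx Hy).
  - exact (proximal_not_mixed f y x l Hg (proximal_sym _ _ _ Hp) Hy Hx).
  - apply Ha. exact (proximal_finite_asymptotic f x y l l' Hg Hp Hx Hy).
Qed.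

(** Proximality holds along some class [j], which gives a common limit there; iterating moves it to
    any class [i]. *)
Lemma proximal_common_limit f x y r i : good f -> (1 <= r)%nat -> proximal f x y ->
  exists w, omega_mod f x r i w /\ omega_mod f y r i w.
Proof.
  intros Hg Hr Hp. destruct (proj1 (proj2 Hg)) as (M & HM).
  destruct (small_in_some_residue (fun n => iter n f x - iter n f y) r Hr Hp) as (j & Hj & Hs).
  assert (Hch : forall k, exists n, (n >= k)%nat /\ (n mod r = j mod r)%nat /\
    Rabs (iter n f x - iter n f y) < / (INR k + 1)).
  { intros k. apply Hs. apply Rinv_0_lt_compat. assert (A := pos_INR k); lra. }
  apply choice in Hch. destruct Hch as (n & Hn).
  destruct (bounded_adherent (fun k => iter (n k) f x) (Rmax (Rabs x) M)) as (w & Hw).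
  { intros k. now apply iter_bounded. }
  assert (Hx : omega_mod f x r j w).
  { intros eps He N. destruct (Hw eps He N) as (k & Hk & Hd). destruct (Hn k) as (A & B & _).
    exists (n k). split; [lia|]. auto. }
  assert (Hy : omega_mod f y r j w).
  { intros eps He N. destruct (inv_INR_lt (eps / 2)) as (K & HK); [lra|].
    destruct (Hw (eps / 2) ltac:(lra) (N + K)%nat) as (k & Hk & Hd). destruct (Hn k) as (A & B & C).
    specialize (HK k ltac:(lia)). exists (n k). split; [lia|]. split; auto.
    assert (C' : Rabs (iter (n k) f x - iter (n k) f y) < eps / 2) by lra.
    assert (D := Rabs_tri3 _ _ _ _ _ C' Hd). lra. }
  assert (E : ((j + (i + r * j - j)) mod r = i mod r)%nat).
  { replace (j + (i + r * j - j))%nat with (j * r + i)%nat by nia. apply mod_add_mult. }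
  exists (iter (i + r * j - j) f w). split; apply (omega_mod_congr _ _ _ _ _ _ E);
    apply omega_mod_image; auto; apply (proj1 Hg).
Qed.

Lemma pow2_pos k : (1 <= 2 ^ k)%nat.
Proof. assert (A := Nat.pow_nonzero 2 k). lia. Qed.

Lemma mod_pow2_split k n i : (i < 2 ^ k)%nat -> (n mod 2 ^ k = i)%nat ->
  (n mod 2 ^ S k = i \/ n mod 2 ^ S k = i + 2 ^ k)%nat.
Proof.
  intros Hi E. rewrite Nat.pow_succ_r', Nat.mul_comm, Nat.Div0.mod_mul_r, E.
  assert (A := Nat.mod_upper_bound (n / 2 ^ k) 2 ltac:(lia)).
  destruct (Nat.eq_dec ((n / 2 ^ k) mod 2) 0) as [B|B]; [left; nia|right].
  replace ((n / 2 ^ k) mod 2)%nat with 1%nat by lia. lia.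
Qed.

Lemma mod_pow2_le k k' n i : (k <= k')%nat -> (n mod 2 ^ k' = i mod 2 ^ k')%nat ->
  (n mod 2 ^ k = i mod 2 ^ k)%nat.
Proof.
  intros Hk H. replace k' with (k + (k' - k))%nat in H by lia. rewrite Nat.pow_add_r in H.
  rewrite !Nat.Div0.mod_mul_r in H. assert (A := pow2_pos k).
  apply (f_equal (fun t => t mod 2 ^ k)%nat) in H.
  rewrite !(Nat.mul_comm (2 ^ k)), !Nat.Div0.mod_add, !Nat.Div0.mod_mod in H. exact H.
Qed.

(** A class modulo [2^k] met infinitely often splits into two classes modulo [2^(k+1)], one of which
    is again met infinitely often. *)
Lemma exists_nested_residues (P : nat -> Prop) :
  (forall N, exists n, (n >= N)%nat /\ P n) ->
  exists i : nat -> nat, (forall k, (i k < 2 ^ k)%nat) /\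
    (forall k, (i (S k) mod 2 ^ k = i k mod 2 ^ k)%nat) /\
    forall k N, exists n, (n >= N)%nat /\ (n mod 2 ^ k = i k mod 2 ^ k)%nat /\ P n.
Proof.
  intros HP.
  set (Q := fun k i => forall N, exists n, (n >= N)%nat /\ (n mod 2 ^ k = i)%nat /\ P n).
  set (i := fix i k := match k with O => O
    | S k' => if excluded_middle_informative (Q (S k') (i k')) then i k' else (i k' + 2 ^ k')%nat end).
  assert (Hi : forall k, (i k < 2 ^ k)%nat).
  { induction k; [simpl; lia|]. simpl i. rewrite Nat.pow_succ_r'. destruct excluded_middle_informative; lia. }
  assert (HQ : forall k, Q k (i k)).
  { induction k as [|k IH].
    - intros N. destruct (HP N) as (n & Hn & Hp). exists n. split; auto.
    - simpl i. destruct excluded_middle_informative as [H|H]; auto.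
      apply not_all_ex_not in H. destruct H as (N' & H). intros N.
      destruct (IH (N + N')%nat) as (n & Hn & Hm & Hp). exists n. split; [lia|]. split; auto.
      destruct (mod_pow2_split k n (i k) (Hi k) Hm) as [E|E]; auto.
      exfalso. apply H. exists n. split; [lia|auto]. }
  exists i. split; auto. split.
  - intros k. simpl i. destruct excluded_middle_informative; auto.
    rewrite <- (Nat.mul_1_l (2 ^ k)) at 1. now rewrite Nat.Div0.mod_add.
  - intros k N. destruct (HQ k N) as (n & Hn & Hm & Hp). exists n. split; auto. split; auto.
    rewrite (Nat.mod_small (i k)); auto.
Qed.

Lemma IsJ_iff f x k i a b : IsJ f x k i a b <->
  is_min (omega_mod f x (2 ^ k) i) a /\ is_max (omega_mod f x (2 ^ k) i) b.
Proof.
  assert (A := fun y => omega_iter_iff f x (2 ^ k) i y (pow2_pos k)).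
  unfold IsJ, is_min, is_max. split; intros ((H1 & H2) & H3 & H4);
    (split; split; [now apply A| |now apply A|]); intros y Hy; first [apply H2|apply H4]; now apply A.
Qed.

Lemma omega_mod_pow2_le f x k k' i y : (k <= k')%nat -> omega_mod f x (2 ^ k') i y ->
  omega_mod f x (2 ^ k) i y.
Proof.
  intros Hk H eps He N. destruct (H eps He N) as (n & A & B & C). exists n. split; auto. split; auto.
  now apply (mod_pow2_le k k').
Qed.

Lemma nested_intersection (a b : nat -> R) e : e > 0 ->
  (forall k, a k <= a (S k) /\ b (S k) <= b k) -> (forall k, e <= b k - a k) ->
  exists u v, u < v /\ forall z, (forall k, (k >= 1)%nat -> a k <= z <= b k) <-> u <= z <= v.
Proof.
  intros He Hn Hl.
  assert (Ha : forall k m, a k <= a (m + k)%nat) by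
    (intros k m; induction m; simpl; [lra|destruct (Hn (m + k)%nat); lra]).
  assert (Hb : forall k m, b (m + k)%nat <= b k) by
    (intros k m; induction m; simpl; [lra|destruct (Hn (m + k)%nat); lra]).
  assert (Hab : forall k m, a k + e <= b m).
  { intros k m. assert (A := Ha k m). assert (B := Hb m k). rewrite Nat.add_comm in B.
    assert (C := Hl (m + k)%nat). lra. }
  destruct (completeness (fun y => exists k, y = a k)) as (u & Hu1 & Hu2).
  { exists (b 0%nat). intros y (k & ->). specialize (Hab k 0%nat). lra. }
  { exists (a 0%nat). eauto. }
  destruct (completeness (fun y => exists k, y = - b k)) as (v & Hv1 & Hv2).
  { exists (- a 0%nat). intros y (k & ->). specialize (Hab 0%nat k). lra. }
  { exists (- b 0%nat). eauto. }
  exists u, (- v). split.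
  - assert (v <= - u - e); [|lra]. apply Hv2. intros y (k & ->).
    assert (u <= b k - e); [|lra]. apply Hu2. intros y (m & ->). specialize (Hab m k). lra.
  - intros z. split.
    + intros H. split.
      * apply Hu2. intros y (k & ->). assert (A := Ha k 1%nat). specialize (H (1 + k)%nat ltac:(lia)). lra.
      * assert (v <= - z); [|lra]. apply Hv2. intros y (k & ->).
        assert (A := Hb k 1%nat). specialize (H (1 + k)%nat ltac:(lia)). lra.
    + intros H k _. assert (A := Hu1 (a k) (ex_intro _ k eq_refl)).
      assert (B := Hv1 (- b k) (ex_intro _ k eq_refl)). lra.
Qed.

Lemma wide_nested_nonseparable f x (i : nat -> nat) a b e : inI x -> infinite_set (omega f x) ->
  (forall k, (i k < 2 ^ k)%nat) -> (forall k, (i (S k) mod 2 ^ k = i k mod 2 ^ k)%nat) ->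
  (forall k, is_min (omega_mod f x (2 ^ k) (i k)) (a k) /\ is_max (omega_mod f x (2 ^ k) (i k)) (b k)) ->
  e > 0 -> (forall k, e <= b k - a k) -> exists u v, nonseparable_pair f u v.
Proof.
  intros Hx Hinf Hi Hin HJ He Hw.
  assert (Hn : forall k, a k <= a (S k) /\ b (S k) <= b k).
  { intros k. destruct (HJ k) as ((A1 & A2) & (A3 & A4)), (HJ (S k)) as ((B1 & B2) & (B3 & B4)).
    split; [apply A2|apply A4]; apply (omega_mod_congr _ _ _ _ _ _ (Hin k)),
      (omega_mod_pow2_le f x k (S k)); auto. }
  destruct (nested_intersection a b e He Hn Hw) as (u & v & Huv & Hz).
  exists u, v. split; [lra|]. exists x. split; auto. split; auto.
  exists i, a, b. split; [|split; auto].
  - intros k _. split; auto. now apply IsJ_iff.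
  - intros z. rewrite Rmin_left, Rmax_right by lra. apply Hz.
Qed.

(* Some nested residue classes [i_k mod 2^k] carry infinitely many times at which the two orbits
   are [eps] apart. The hulls of the two omega-limit sets along such a class meet, so one
   of them has length at least [eps/2]. *)
Lemma scrambled_nonseparable f x y : good f -> inI x -> inI y -> scrambled_pair f x y ->
  exists u v, nonseparable_pair f u v.
Proof.
  intros Hg Hx Hy Hs. destruct (scrambled_infinite_omega f x y Hg Hs) as (Hix & Hiy).
  destruct Hs as (Hp & Ha).
  apply not_all_ex_not in Ha. destruct Ha as (e & Ha). apply imply_to_and in Ha.
  destruct Ha as (He & Ha).
  assert (Hfar : forall N, exists n, (n >= N)%nat /\ e <= Rabs (iter n f x - iter n f y)).
  { intros N. apply NNPP. intros Hn. apply Ha. exists N. intros n Hge.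
    apply Rnot_le_lt. intros Hle. apply Hn. eauto. }
  destruct (exists_nested_residues _ Hfar) as (i & Hi & Hin & HP).
  assert (Hex : forall z k, exists ab : R * R, is_min (omega_mod f z (2 ^ k) (i k)) (fst ab) /\
    is_max (omega_mod f z (2 ^ k) (i k)) (snd ab)).
  { intros z k. destruct (omega_mod_extrema f z (2 ^ k) (i k) Hg (pow2_pos k)) as (a & b & H).
    exists (a, b). exact H. }
  destruct (choice _ (Hex x)) as (J & HJ). destruct (choice _ (Hex y)) as (J' & HJ').
  set (len := fun k => snd (J k) - fst (J k)). set (len' := fun k => snd (J' k) - fst (J' k)).
  assert (Hsum : forall k, e <= len k + len' k).
  { intros k. apply Rnot_lt_le. intros Hlt. unfold len, len' in Hlt.
    destruct (proximal_common_limit f x y (2 ^ k) (i k) Hg (pow2_pos k) Hp) as (w & Hw1 & Hw2).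
    destruct (HJ k) as ((A1 & A2) & (A3 & A4)), (HJ' k) as ((B1 & B2) & (B3 & B4)).
    (* A third of the deficit: the two lengths plus two errors [t] still sum to less than [e]. *)
    set (t := (e - (snd (J k) - fst (J k) + (snd (J' k) - fst (J' k)))) / 3).
    assert (Ht : t > 0) by (unfold t; lra).
    destruct (omega_mod_eventually_near f x (2 ^ k) (i k) t Hg Ht) as (N & HN).
    destruct (omega_mod_eventually_near f y (2 ^ k) (i k) t Hg Ht) as (N' & HN').
    destruct (HP k (N + N')%nat) as (n & Hn & Hm & Hf).
    destruct (HN n ltac:(lia) Hm) as (p & Hpp & Hpd).
    destruct (HN' n ltac:(lia) Hm) as (q & Hqq & Hqd).
    assert (C1 := A2 _ Hw1). assert (C2 := A4 _ Hw1). assert (C3 := B2 _ Hw2). assert (C4 := B4 _ Hw2).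
    assert (D1 := A2 _ Hpp). assert (D2 := A4 _ Hpp). assert (D3 := B2 _ Hqq). assert (D4 := B4 _ Hqq).
    apply Rabs_def2 in Hpd, Hqd.
    assert (Rabs (iter n f x - iter n f y) < e); [|lra].
    apply Rabs_def1; unfold t in *; lra. }
  assert (Hmono : forall z J0, (forall k, is_min (omega_mod f z (2 ^ k) (i k)) (fst (J0 k)) /\
    is_max (omega_mod f z (2 ^ k) (i k)) (snd (J0 k))) ->
    forall k m, snd (J0 (m + k)%nat) - fst (J0 (m + k)%nat) <= snd (J0 k) - fst (J0 k)).
  { intros z J0 H k m. induction m as [|m IH]; [simpl; lra|].
    destruct (H (m + k)%nat) as ((A1 & A2) & (A3 & A4)), (H (S m + k)%nat) as ((B1 & B2) & (B3 & B4)).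
    apply (omega_mod_pow2_le f z (m + k) (S m + k)) in B1; [|lia].
    apply (omega_mod_pow2_le f z (m + k) (S m + k)) in B3; [|lia].
    apply (omega_mod_congr _ _ _ _ _ _ (Hin (m + k)%nat)) in B1, B3.
    specialize (A2 _ B1). specialize (A4 _ B3). lra. }
  (* The lengths do not increase with the level. If [len] is below [e / 2] at [k0], then [len'] is
     at least [e / 2] at every later level, hence at every level. *)
  destruct (classic (forall k, e / 2 <= len k)) as [H|H].
  - apply (wide_nested_nonseparable f x i (fun k => fst (J k)) (fun k => snd (J k)) (e / 2)); auto; lra.
  - apply not_all_ex_not in H. destruct H as (k0 & Hk0).
    apply (wide_nested_nonseparable f y i (fun k => fst (J' k)) (fun k => snd (J' k)) (e / 2)); auto; [lra|].
    intros k. assert (A := Hmono x J HJ k0 k). assert (B := Hmono y J' HJ' k k0).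
    assert (C := Hsum (k + k0)%nat). unfold len, len' in *. rewrite (Nat.add_comm k0) in B. lra.
Qed.

(** * Expansion near a nonseparable pair *)

Definition convex (T : R -> Prop) : Prop := forall a b c, T a -> T b -> a <= c <= b -> T c.

(** Multiplying both sides by [s] treats an inequality and its mirror image at once. *)
Definition sign (s : R) : Prop := s = 1 \/ s = -1.

Lemma convex_image h T s p q c : continuity h -> convex T -> sign s -> T p -> T q ->
  s * h p <= s * c <= s * h q -> exists y, T y /\ h y = c.
Proof.
  intros Hc HT Hs Hp Hq H.
  assert (A : exists y, Rmin p q <= y <= Rmax p q /\ h y = c).
  { destruct Hs as [-> | ->]; [apply ivt_any; auto; lra|].
    rewrite Rmin_comm, Rmax_comm. apply ivt_any; auto; lra. }
  destruct A as (y & Hy & E). exists y. split; auto.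
  destruct (Rle_dec p q).
  - rewrite Rmin_left, Rmax_right in Hy by lra. eauto.
  - rewrite Rmin_right, Rmax_left in Hy by lra. eauto.
Qed.

Lemma alternates_side g y z N b : alternates g y z N -> exists s, sign s /\
  forall n, (n >= N)%nat -> if Bool.eqb (Nat.even n) b then s * iter n g y < s * z
                            else s * z < s * iter n g y.
Proof.
  intros H.
  set (P := fun s n => if Bool.eqb (Nat.even n) b then s * iter n g y < s * z
                       else s * z < s * iter n g y).
  assert (H0 : exists s, sign s /\ P s N).
  { destruct (H N (le_n N)) as [[A _]|[_ A]]; unfold P;
      destruct (Bool.eqb (Nat.even N) b);
      first [exists 1; split; [now left|lra] | exists (-1); split; [now right|lra]]. }
  destruct H0 as (s & Hs & HP). exists s. split; auto.
  intros n Hn. change (P s n). replace n with (n - N + N)%nat by lia.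
  induction (n - N)%nat as [|m IH]; auto.
  specialize (H (m + N)%nat ltac:(lia)). unfold P in *.
  change (S m + N)%nat with (S (m + N)). rewrite Nat.even_succ, <- Nat.negb_even.
  destruct (Nat.even (m + N)), b; simpl Bool.eqb in *; cbv iota in *;
    destruct Hs as [-> | ->]; lra.
Qed.

Lemma even_2_add n q : Nat.even (2 * n + q) = Nat.even q.
Proof. rewrite Nat.even_add, Nat.even_mul. simpl. now destruct (Nat.even q). Qed.

(* [Y j] and [Z j] are on opposite sides of [z], so the image of [T] contains everything between
   them. Waiting until [Y j] is in the outer position, it contains the later points [Y m] in the inner
   position; one step of [g^2] later these are outer and yield all points in the class of [Y (j+1)]. *)
Lemma expansion_mod4 g y T p q : good g -> infinite_set (omega g y) -> convex T ->
  T (iter p g y) -> T (iter q g y) -> Nat.even p <> Nat.even q ->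
  exists t N, forall n, (n >= N)%nat -> (n mod 4 = (q + t) mod 4)%nat ->
    exists w, T w /\ iter t g w = iter n g y.
Proof.
  intros Hg Hinf HT Hp Hq Hpq. assert (Hc := proj1 Hg).
  destruct (infinite_omega_alternates g y Hg Hinf) as (z & N & _ & Hz).
  destruct (alternates_side g y z N (Nat.even q) Hz) as (s & Hs & Hside).
  destruct (infinite_omega_alternates (iter 2 g) (iter q g y)) as (z2 & N2 & _ & Hz2).
  { apply good_iter; auto. }
  { apply infinite_omega_iter; auto. }
  destruct (alternates_side _ _ z2 N2 true Hz2) as (s2 & Hs2 & Hside2).
  set (Y := fun j => iter (2 * j + q) g y). set (Z := fun j => iter (2 * j + p) g y).
  set (J := (N + N2)%nat).
  assert (HY : forall j, (j >= J)%nat -> s * Y j < s * z).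
  { intros j Hj. specialize (Hside (2 * j + q)%nat ltac:(lia)).
    rewrite even_2_add, Bool.eqb_reflx in Hside. exact Hside. }
  assert (HZ : forall j, (j >= J)%nat -> s * z < s * Z j).
  { intros j Hj. specialize (Hside (2 * j + p)%nat ltac:(lia)). rewrite even_2_add in Hside.
    destruct (Bool.eqb (Nat.even p) (Nat.even q)) eqn:E; [|exact Hside].
    apply Bool.eqb_prop in E. contradiction. }
  assert (Hj0 : exists j, (j >= J)%nat /\ forall m, (m >= J)%nat ->
    if Bool.eqb (Nat.even m) (Nat.even j) then s * Y m < s * z2 else s * z2 < s * Y m).
  { assert (HY2 : forall m, iter m (iter 2 g) (iter q g y) = Y m).
    { intros m. rewrite iter_mul, <- iter_add. unfold Y. f_equal. lia. }
    assert (Ev : Nat.even (2 * J) = true) by (rewrite Nat.even_mul; auto).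
    (* Whether the orientation [s2] of the alternation of [g^2] agrees with [s] decides if the even
       or the odd indices are the outer ones. *)
    assert (Hcase : s2 = s \/ s2 = - s) by (destruct Hs as [-> | ->], Hs2 as [-> | ->]; lra).
    destruct Hcase as [-> | ->].
    - exists (2 * J)%nat. split; [lia|]. intros m Hm. rewrite Ev.
      specialize (Hside2 m ltac:(lia)). now rewrite HY2 in Hside2.
    - exists (S (2 * J)). split; [lia|]. intros m Hm. rewrite Nat.even_succ, <- Nat.negb_even, Ev.
      specialize (Hside2 m ltac:(lia)). rewrite HY2 in Hside2.
      destruct (Nat.even m); simpl Bool.eqb in *; cbv iota in *; lra. }
  destruct Hj0 as (j & Hj & Hpos).
  assert (Hinner : forall m, (m >= J)%nat -> Nat.even m = negb (Nat.even j) ->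
    exists w, T w /\ iter (2 * j) g w = Y m).
  { intros m Hm Em. apply (convex_image (iter (2 * j) g) T s (iter q g y) (iter p g y)); auto.
    { now apply continuity_iter. }
    rewrite <- !iter_add. fold (Y j). fold (Z j).
    assert (A := Hpos m Hm). assert (B := Hpos j Hj). rewrite Bool.eqb_reflx in B.
    rewrite Em in A. assert (C := HY m Hm). assert (D := HZ j Hj).
    destruct (Nat.even j); simpl in A; lra. }
  destruct (Hinner (S j) ltac:(lia)) as (w & Hw & Ew).
  { now rewrite Nat.even_succ, <- Nat.negb_even. }
  exists (2 * S j)%nat, (q + 2 * S j)%nat. intros n Hn Hmod.
  destruct (mod_eq_add n (q + 2 * S j) 4 ltac:(lia) Hn Hmod) as (k & ->).
  set (m := (2 * k + S j)%nat).
  assert (Em : Nat.even m = negb (Nat.even j)).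
  { unfold m. now rewrite even_2_add, Nat.even_succ, <- Nat.negb_even. }
  replace (k * 4 + (q + 2 * S j))%nat with (2 * m + q)%nat by (unfold m; lia). fold (Y m).
  apply (convex_image (iter (2 * S j) g) T s w (iter p g y)); auto.
  { now apply continuity_iter. }
  replace (iter (2 * S j) g w) with (Y (S (S j))).
  2:{ replace (2 * S j)%nat with (2 + 2 * j)%nat by lia. rewrite iter_add, Ew. unfold Y.
      rewrite <- iter_add. f_equal. lia. }
  rewrite <- iter_add. fold (Z (S j)).
  assert (A := Hpos m ltac:(unfold m; lia)). assert (B := Hpos (S (S j)) ltac:(lia)).
  assert (C := HY m ltac:(unfold m; lia)). assert (D := HZ (S j) ltac:(lia)).
  change (Nat.even (S (S j))) with (Nat.even j) in B. rewrite Bool.eqb_reflx in B.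
  rewrite Em in A. destruct (Nat.even j); simpl in A; lra.
Qed.

(** Only orbit points of one class are asked for; closedness and convexity of images turn this into
    intervals in [covers_side]. *)
Definition covers (f : R -> R) (x : R) (T : R -> Prop) (t r c N : nat) : Prop :=
  forall n, (n >= N)%nat -> (n mod r = c mod r)%nat -> exists y, T y /\ iter t f y = iter n f x.

Lemma mod_cancel m c s r : (1 <= r)%nat -> ((m + s) mod r = (c + s) mod r)%nat ->
  (m mod r = c mod r)%nat.
Proof.
  intros Hr H. destruct (le_lt_dec c m) as [L|L].
  - destruct (mod_eq_add (m + s) (c + s) r Hr ltac:(lia) H) as (q & E).
    replace m with (q * r + c)%nat by lia. apply mod_add_mult.
  - symmetry in H. destruct (mod_eq_add (c + s) (m + s) r Hr ltac:(lia) H) as (q & E).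
    replace c with (q * r + m)%nat by lia. symmetry. apply mod_add_mult.
Qed.

Lemma covers_shift f x T t r c N s : (1 <= r)%nat -> covers f x T t r c N ->
  covers f x T (s + t) r (c + s) (N + s).
Proof.
  intros Hr H n Hn Hm. replace n with (n - s + s)%nat in Hm by lia. apply mod_cancel in Hm; auto.
  destruct (H (n - s)%nat ltac:(lia) Hm) as (y & Hy & E). exists y. split; auto.
  rewrite iter_add, E, <- iter_add. f_equal. lia.
Qed.

(** For [f^(2^m)] the times [p] and [q] have different parities, so [expansion_mod4] applies, and a
    class modulo 4 there is a class modulo [2^(m+2)] for [f]. Iterating further gives all larger
    [t]. *)
Lemma expansion f x T p q m : good f -> infinite_set (omega f x) -> convex T ->
  T (iter p f x) -> T (iter q f x) ->
  (p mod 2 ^ m = q mod 2 ^ m)%nat -> (p mod 2 ^ S m <> q mod 2 ^ S m)%nat ->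
  exists t0, forall t, (t >= t0)%nat -> exists N, covers f x T t (2 ^ (m + 2)) (q + t) N.
Proof.
  intros Hg Hinf HT Hp Hq E Hne. assert (Hpow := pow2_pos m).
  assert (Hpar : forall d r : nat, ((d * 2 ^ m + r) mod 2 ^ S m <> r mod 2 ^ S m)%nat ->
    Nat.even d = false).
  { intros d r H. destruct (Nat.even d) eqn:Ev; auto. exfalso. apply H.
    apply Nat.even_spec in Ev. destruct Ev as (c & ->).
    replace (2 * c * 2 ^ m + r)%nat with (c * 2 ^ S m + r)%nat by (rewrite Nat.pow_succ_r'; lia).
    apply mod_add_mult. }
  assert (Hdec : exists r p' q', p = (p' * 2 ^ m + r)%nat /\ q = (q' * 2 ^ m + r)%nat /\
    Nat.even p' <> Nat.even q').
  { destruct (le_lt_dec p q) as [L|L].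
    - symmetry in E. destruct (mod_eq_add q p _ Hpow L E) as (d & ->).
      exists p, 0%nat, d. split; [lia|]. split; [lia|]. simpl.
      assert (A := Hpar d p ltac:(auto)). now rewrite A.
    - destruct (mod_eq_add p q _ Hpow ltac:(lia) E) as (d & ->).
      exists q, d, 0%nat. split; [lia|]. split; [lia|]. simpl. now rewrite (Hpar d q Hne). }
  destruct Hdec as (r & p' & q' & -> & -> & Hd).
  destruct (expansion_mod4 (iter (2 ^ m) f) (iter r f x) T p' q') as (t & N & H); auto.
  { now apply good_iter. }
  { now apply infinite_omega_iter. }
  { now rewrite iter_mul, <- iter_add. }
  { now rewrite iter_mul, <- iter_add. }
  assert (H4 : (2 ^ (m + 2) = 4 * 2 ^ m)%nat) by (rewrite Nat.pow_add_r; simpl; lia).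
  assert (Hc : covers f x T (t * 2 ^ m) (2 ^ (m + 2)) (q' * 2 ^ m + r + t * 2 ^ m)
    (N * 2 ^ m + (q' * 2 ^ m + r + t * 2 ^ m))).
  { intros n Hn Hmod.
    destruct (mod_eq_add n (q' * 2 ^ m + r + t * 2 ^ m) _ (pow2_pos _) ltac:(lia) Hmod) as (k & ->).
    destruct (H (k * 4 + (q' + t))%nat) as (w & Hw & Ew); [nia|apply mod_add_mult|].
    exists w. split; auto. rewrite !iter_mul, <- iter_add in Ew. rewrite Ew. f_equal. nia. }
  exists (t * 2 ^ m)%nat. intros t' Ht'. eexists.
  assert (A := covers_shift _ _ _ _ _ _ _ (t' - t * 2 ^ m) (pow2_pos _) Hc).
  replace (t' - t * 2 ^ m + t * 2 ^ m)%nat with t' in A by lia.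
  replace (q' * 2 ^ m + r + t * 2 ^ m + (t' - t * 2 ^ m))%nat with (q' * 2 ^ m + r + t')%nat in A
    by lia. exact A.
Qed.

Lemma residues_split p q k : (p mod 2 ^ k <> q mod 2 ^ k)%nat -> exists m, (m < k)%nat /\
  (p mod 2 ^ m = q mod 2 ^ m)%nat /\ (p mod 2 ^ S m <> q mod 2 ^ S m)%nat.
Proof.
  induction k as [|k IH]; intros H; [exfalso; apply H; simpl; reflexivity|].
  destruct (Nat.eq_dec (p mod 2 ^ k) (q mod 2 ^ k)) as [E|E].
  - exists k. auto.
  - destruct (IH E) as (m & A & B). exists m. split; [lia|auto].
Qed.

Definition coherent (i : nat -> nat) : Prop :=
  forall k k', (k <= k')%nat -> (i k' mod 2 ^ k = i k mod 2 ^ k)%nat.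

Lemma step_coherent i : (forall k, (i (S k) mod 2 ^ k = i k mod 2 ^ k)%nat) -> coherent i.
Proof.
  intros H k k' Hk. induction Hk as [|k' Hk IH]; auto. rewrite <- IH.
  apply (mod_pow2_le k k'); auto.
Qed.

Definition visited (f : R -> R) (x : R) (i : nat -> nat) (T : R -> Prop) : Prop :=
  forall k N, exists n, (n >= N)%nat /\ (n mod 2 ^ k = i k mod 2 ^ k)%nat /\ T (iter n f x).

Lemma visited_expansion f x i T : good f -> infinite_set (omega f x) -> coherent i ->
  convex T -> visited f x i T -> exists K t0, forall t, (t >= t0)%nat ->
    exists N, covers f x T t (2 ^ K) (i K + t) N.
Proof.
  intros Hg Hinf Hi HT Hv.
  destruct (Hv 0%nat 0%nat) as (p1 & _ & _ & Hp1). destruct (Hv 0%nat (S p1)) as (p2 & Hp12 & _ & Hp2).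
  (* [2^p2] exceeds both times, so [p1] and [p2] differ modulo [2^k] and at least one of them is
     outside the class of [i k]. *)
  set (k := p2).
  assert (Hlt : (p2 < 2 ^ k)%nat) by (apply Nat.pow_gt_lin_r; lia).
  assert (Hp : exists p, T (iter p f x) /\ (p mod 2 ^ k <> i k mod 2 ^ k)%nat).
  { destruct (Nat.eq_dec (p1 mod 2 ^ k) (i k mod 2 ^ k)) as [E|E]; [|eauto].
    exists p2. split; auto. rewrite <- E, !Nat.mod_small by lia. lia. }
  destruct Hp as (p & HTp & Hpk).
  (* Level [S k], because a split at [m < k] yields a class modulo [2^(m+2)] and [m + 2 <= S k]. *)
  destruct (Hv (S k) 0%nat) as (q & _ & Hq & HTq).
  assert (Hqk : (q mod 2 ^ k = i k mod 2 ^ k)%nat).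
  { rewrite <- (Hi k (S k)) by lia. now apply (mod_pow2_le k (S k)); [lia|]. }
  rewrite <- Hqk in Hpk. destruct (residues_split p q k Hpk) as (m & Hm & E & Hne).
  destruct (expansion f x T p q m Hg Hinf HT HTp HTq E Hne) as (t0 & Ht0).
  exists (m + 2)%nat, t0. intros t Ht. destruct (Ht0 t Ht) as (N & HN).
  exists N. intros n Hn Hmod. apply HN; auto. rewrite Hmod.
  assert (Hqm : (q mod 2 ^ (m + 2) = i (m + 2) mod 2 ^ (m + 2))%nat).
  { rewrite <- (Hi (m + 2)%nat (S k)) by lia. now apply (mod_pow2_le (m + 2) (S k)); [lia|]. }
  rewrite Nat.Div0.add_mod, <- Hqm, <- Nat.Div0.add_mod. reflexivity.
Qed.

Lemma covers_refine f x i T t K K' N : coherent i -> (K <= K')%nat ->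
  covers f x T t (2 ^ K) (i K + t) N -> covers f x T t (2 ^ K') (i K' + t) N.
Proof.
  intros Hi HK H n Hn Hm. apply H; auto. apply (mod_pow2_le K K') in Hm; auto. rewrite Hm.
  rewrite Nat.Div0.add_mod, (Hi K K' HK), <- Nat.Div0.add_mod. reflexivity.
Qed.

(** Two visits to [w] would make it a periodic limit point. *)
Lemma eventually_off_limit f x w : good f -> infinite_set (omega f x) -> omega f x w ->
  exists N, forall n, (n >= N)%nat -> iter n f x <> w.
Proof.
  intros Hg Hinf Hw. apply NNPP. intros Hn.
  assert (H : forall N, exists n, (n >= N)%nat /\ iter n f x = w).
  { intros N. apply NNPP. intros HN. apply Hn. exists N. intros n Hge E. apply HN. eauto. }
  destruct (H 0%nat) as (n & _ & En). destruct (H (S n)) as (m & Hm & Em).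
  apply (infinite_omega_no_periodic f x w (m - n) Hg Hinf ltac:(lia)); auto.
  rewrite <- En at 1. rewrite <- iter_add. now replace (m - n + n)%nat with m by lia.
Qed.

Definition side (s w e y : R) : Prop := 0 <= s * (y - w) <= e.

Lemma side_convex s w e : sign s -> convex (side s w e).
Proof. intros [-> | ->] a b c; unfold side; lra. Qed.

(** The orbit is eventually off [w], so a late close visit is on one of the two sides. Were each
    side missed from some level and time on, a visit at level [k1 + k2] would be on neither. *)
Lemma limit_one_sided f x i w : good f -> infinite_set (omega f x) -> coherent i ->
  (forall k, omega_mod f x (2 ^ k) (i k) w) ->
  exists s, sign s /\ forall e, e > 0 -> visited f x i (fun y => 0 < s * (y - w) < e).
Proof.
  intros Hg Hinf Hi Hw. apply NNPP. intros Hn.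
  assert (A : forall s, sign s -> exists e k N, e > 0 /\ forall n, (n >= N)%nat ->
    (n mod 2 ^ k = i k mod 2 ^ k)%nat -> ~ 0 < s * (iter n f x - w) < e).
  { intros s Hs. apply NNPP. intros H. apply Hn. exists s. split; auto. intros e He k N.
    apply NNPP. intros HN. apply H. exists e, k, N. split; auto.
    intros n Hge Hm Hlt. apply HN. eauto. }
  destruct (A 1 (or_introl eq_refl)) as (e1 & k1 & N1 & He1 & H1).
  destruct (A (-1) (or_intror eq_refl)) as (e2 & k2 & N2 & He2 & H2).
  destruct (eventually_off_limit f x w Hg Hinf) as (N0 & H0).
  { exact (omega_mod_omega _ _ _ _ _ (Hw 0%nat)). }
  destruct (Hw (k1 + k2)%nat (Rmin e1 e2) ltac:(now apply Rmin_glb_lt) (N0 + N1 + N2)%nat)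
    as (n & Hge & Hm & Hd).
  assert (B1 := Rmin_l e1 e2). assert (B2 := Rmin_r e1 e2).
  specialize (H0 n ltac:(lia)). apply Rabs_def2 in Hd.
  specialize (H1 n ltac:(lia)). specialize (H2 n ltac:(lia)).
  rewrite <- (Hi k1 (k1 + k2)%nat ltac:(lia)) in H1. rewrite <- (Hi k2 (k1 + k2)%nat ltac:(lia)) in H2.
  specialize (H1 (mod_pow2_le k1 (k1 + k2) _ _ ltac:(lia) Hm)).
  specialize (H2 (mod_pow2_le k2 (k1 + k2) _ _ ltac:(lia) Hm)).
  destruct (Rtotal_order (iter n f x) w) as [C|[C|C]]; [apply H2|contradiction|apply H1]; lra.
Qed.

Lemma closed_image h a b c : continuity h -> a <= b ->
  (forall eps, eps > 0 -> exists p, a <= p <= b /\ Rabs (h p - c) < eps) ->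
  exists p, a <= p <= b /\ h p = c.
Proof.
  intros Hc Hab H.
  destruct (continuity_ab_min h a b Hab) as (m & Hm & Hmb); [intros; apply Hc|].
  destruct (continuity_ab_maj h a b Hab) as (M & HM & HMb); [intros; apply Hc|].
  assert (h m <= c).
  { apply Rnot_lt_le. intros L. destruct (H (h m - c)) as (p & Hp & Hd); [lra|].
    specialize (Hm p Hp). apply Rabs_def2 in Hd. lra. }
  assert (c <= h M).
  { apply Rnot_lt_le. intros L. destruct (H (c - h M)) as (p & Hp & Hd); [lra|].
    specialize (HM p Hp). apply Rabs_def2 in Hd. lra. }
  destruct (ivt_any h m M c Hc (conj H0 H1)) as (p & Hp & E). exists p. split; auto.
  assert (A := Rmin_glb m M a ltac:(lra) ltac:(lra)). assert (B := Rmax_lub m M b ltac:(lra) ltac:(lra)).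
  lra.
Qed.

Lemma side_closed_image h s w e c : continuity h -> sign s -> 0 <= e ->
  (forall eps, eps > 0 -> exists p, side s w e p /\ Rabs (h p - c) < eps) ->
  exists p, side s w e p /\ h p = c.
Proof.
  intros Hc [-> | ->] He H; unfold side in *.
  - destruct (closed_image h w (w + e) c Hc) as (p & Hp & E); [lra| |exists p; split; auto; lra].
    intros eps Heps. destruct (H eps Heps) as (p & Hp & Hd). exists p. split; auto. lra.
  - destruct (closed_image h (w - e) w c Hc) as (p & Hp & E); [lra| |exists p; split; auto; lra].
    intros eps Heps. destruct (H eps Heps) as (p & Hp & Hd). exists p. split; auto. lra.
Qed.

(** Covered orbit points approach [w'] from the side [s']. The image of the closed leg is closed, so
    it contains [w']; being an interval, it contains everything from [w'] to one such orbit point,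
    whose distance is [e'']. *)
Lemma covers_side f x i K T t N s w e : good f -> sign s -> 0 <= e ->
  (T = side s w e) -> covers f x T t (2 ^ K) (i K) N ->
  forall s' w' e', sign s' ->
  (forall eps, eps > 0 -> visited f x i (fun y => 0 < s' * (y - w') < eps)) -> 0 < e' ->
  exists e'', 0 < e'' < e' /\
    forall d, 0 < d <= e'' -> forall p, side s' w' d p -> exists q, T q /\ iter t f q = p.
Proof.
  intros Hg Hs He HTe HT s' w' e' Hs' Hv' He'. subst T.
  assert (Hc := continuity_iter f t (proj1 Hg)).
  destruct (Hv' e' He' K N) as (n & Hn & Hm & Hd).
  exists (s' * (iter n f x - w')). split; [lra|]. intros d Hd' p Hp.
  destruct (HT n Hn Hm) as (y & Hy & Ey).
  assert (Hw : exists y0, side s w e y0 /\ iter t f y0 = w').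
  { apply side_closed_image; auto. intros eps Heps.
    destruct (Hv' eps Heps K N) as (n' & Hn' & Hm' & Hd'').
    destruct (HT n' Hn' Hm') as (y' & Hy' & Ey'). exists y'. split; auto. rewrite Ey'.
    destruct Hs' as [-> | ->]; apply Rabs_def1; lra. }
  destruct Hw as (y0 & Hy0 & Ey0).
  apply (convex_image (iter t f) (side s w e) s' y0 y); auto.
  - now apply side_convex.
  - rewrite Ey0, Ey. unfold side in Hp. lra.
Qed.

(** The time [t] is common to both legs and a multiple of [2^K], so each image contains late orbit
    points of the class [i K] itself, which accumulate at [u] and at [v] from the prescribed sides.
    The bound [e / 2] makes the legs decrease geometrically. *)
Lemma shrinking_horseshoe f x i su u sv v e : good f -> infinite_set (omega f x) -> coherent i ->
  sign su -> sign sv ->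
  (forall eps, eps > 0 -> visited f x i (fun y => 0 < su * (y - u) < eps)) ->
  (forall eps, eps > 0 -> visited f x i (fun y => 0 < sv * (y - v) < eps)) -> 0 < e ->
  exists e' t, 0 < e' < e / 2 /\ (1 <= t)%nat /\
    forall p, side su u e' p \/ side sv v e' p ->
      (exists q, side su u e q /\ iter t f q = p) /\ (exists q, side sv v e q /\ iter t f q = p).
Proof.
  intros Hg Hinf Hi Hsu Hsv Hu Hv He.
  assert (Hvis : forall s w, (forall eps, eps > 0 -> visited f x i (fun y => 0 < s * (y - w) < eps)) ->
    visited f x i (side s w e)).
  { intros s w H k N. destruct (H e He k N) as (n & A & B & C). exists n. split; auto. split; auto.
    unfold side. lra. }
  destruct (visited_expansion f x i (side su u e) Hg Hinf Hi (side_convex _ _ _ Hsu) (Hvis _ _ Hu))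
    as (K1 & t1 & H1).
  destruct (visited_expansion f x i (side sv v e) Hg Hinf Hi (side_convex _ _ _ Hsv) (Hvis _ _ Hv))
    as (K2 & t2 & H2).
  set (K := (K1 + K2)%nat). set (t := ((t1 + t2 + 1) * 2 ^ K)%nat).
  assert (Ht : (t >= t1 + t2 + 1)%nat) by (assert (A := pow2_pos K); unfold t; nia).
  destruct (H1 t ltac:(lia)) as (N1 & C1). destruct (H2 t ltac:(lia)) as (N2 & C2).
  apply (covers_refine f x i _ t K1 K) in C1; [|auto|unfold K; lia].
  apply (covers_refine f x i _ t K2 K) in C2; [|auto|unfold K; lia].
  assert (D : forall T N, covers f x T t (2 ^ K) (i K + t) N -> covers f x T t (2 ^ K) (i K) N).
  { intros T N H n Hn Hm. apply H; auto. rewrite Hm. unfold t.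
    now rewrite Nat.Div0.mod_add. }
  apply D in C1, C2.
  assert (Hh : 0 < e / 2) by lra. assert (He0 : 0 <= e) by lra.
  destruct (covers_side f x i K _ t N1 su u e Hg Hsu He0 eq_refl C1 su u _ Hsu Hu Hh) as (e1 & E1 & F1).
  destruct (covers_side f x i K _ t N1 su u e Hg Hsu He0 eq_refl C1 sv v _ Hsv Hv Hh) as (e2 & E2 & F2).
  destruct (covers_side f x i K _ t N2 sv v e Hg Hsv He0 eq_refl C2 su u _ Hsu Hu Hh) as (e3 & E3 & F3).
  destruct (covers_side f x i K _ t N2 sv v e Hg Hsv He0 eq_refl C2 sv v _ Hsv Hv Hh) as (e4 & E4 & F4).
  set (d := Rmin (Rmin e1 e2) (Rmin e3 e4)).
  assert (A0 := Rmin_l (Rmin e1 e2) (Rmin e3 e4)). assert (A1 := Rmin_r (Rmin e1 e2) (Rmin e3 e4)).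
  assert (A2 := Rmin_l e1 e2). assert (A3 := Rmin_r e1 e2).
  assert (A4 := Rmin_l e3 e4). assert (A5 := Rmin_r e3 e4). fold d in A0, A1.
  assert (Hd : 0 < d) by (repeat apply Rmin_glb_lt; lra).
  exists d, t. split; [lra|]. split; [lia|].
  intros p [Hp|Hp]; split.
  - apply (F1 d); auto; lra.
  - apply (F3 d); auto; lra.
  - apply (F2 d); auto; lra.
  - apply (F4 d); auto; lra.
Qed.

Lemma limit_le_of_close s c z : sign s ->
  (forall eps, eps > 0 -> exists p, Rabs (p - c) < eps /\ s * p < s * z) -> s * c <= s * z.
Proof.
  intros Hs H. apply Rnot_lt_le. intros L. destruct (H (s * c - s * z)) as (p & Hp & Hl); [lra|].
  apply Rabs_def2 in Hp. destruct Hs as [-> | ->]; lra.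
Qed.

(* If [i] and [j] first differ modulo [2^(k+1)], the fixed point around which [f^(2^k)] alternates
   separates the two limit sets. *)
Lemma omega_mod_hulls_disjoint f x k i j y1 y2 w : good f -> infinite_set (omega f x) ->
  omega_mod f x (2 ^ k) i y1 -> omega_mod f x (2 ^ k) i y2 -> omega_mod f x (2 ^ k) j w ->
  y1 <= w <= y2 -> (i mod 2 ^ k = j mod 2 ^ k)%nat.
Proof.
  intros Hg Hinf. revert i j y1 y2 w. induction k as [|k IH]; intros i j y1 y2 w H1 H2 Hw Hb.
  - simpl. reflexivity.
  - assert (E : (i mod 2 ^ k = j mod 2 ^ k)%nat).
    { apply (IH i j y1 y2 w); auto; apply (omega_mod_pow2_le f x k (S k)); auto. }
    destruct (Nat.eq_dec (i mod 2 ^ S k) (j mod 2 ^ S k)) as [|Hne]; auto. exfalso.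
    assert (Hpow := pow2_pos k).
    assert (Ej : (j mod 2 ^ S k = (i + 1 * 2 ^ k) mod 2 ^ S k)%nat).
    { assert (A := Nat.mod_upper_bound i (2 ^ k) ltac:(lia)).
      assert (Hi := mod_pow2_split k i _ A eq_refl). assert (Hj := mod_pow2_split k j _ A (eq_sym E)).
      assert (Hi' : (i mod 2 ^ S k = i mod 2 ^ k -> (i + 1 * 2 ^ k) mod 2 ^ S k = i mod 2 ^ k + 2 ^ k)%nat).
      { intros Ei. rewrite <- Nat.Div0.add_mod_idemp_l, Ei, Nat.mul_1_l. apply Nat.mod_small.
        rewrite Nat.pow_succ_r'. lia. }
      assert (Hi'' : (i mod 2 ^ S k = i mod 2 ^ k + 2 ^ k -> (i + 1 * 2 ^ k) mod 2 ^ S k = i mod 2 ^ k)%nat).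
      { intros Ei. rewrite <- Nat.Div0.add_mod_idemp_l, Ei.
        replace (i mod 2 ^ k + 2 ^ k + 1 * 2 ^ k)%nat with (1 * 2 ^ S k + i mod 2 ^ k)%nat
          by (rewrite Nat.pow_succ_r'; lia).
        rewrite mod_add_mult. apply Nat.mod_small. rewrite Nat.pow_succ_r'. lia. }
      destruct Hi as [Hi|Hi], Hj as [Hj|Hj]; rewrite Hj.
      - exfalso. apply Hne. now rewrite Hi, Hj.
      - now rewrite Hi'.
      - now rewrite Hi''.
      - exfalso. apply Hne. now rewrite Hi, Hj. }
    assert (Hwg : omega (iter (2 ^ k) f) (iter i f x) w).
    { apply omega_iter_iff; auto. apply (omega_mod_congr f x _ j i); auto.
      now apply (omega_mod_pow2_le f x k (S k)); [lia|]. }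
    apply (omega_mod_congr _ _ _ _ _ _ Ej) in Hw.
    set (g := iter (2 ^ k) f) in *. set (y := iter i f x) in *.
    assert (Hgg : good g) by (now apply good_iter).
    assert (Hgi : infinite_set (omega g y)) by (now apply infinite_omega_iter).
    destruct (infinite_omega_alternates g y Hgg Hgi) as (z & N & Ez & Hz).
    destruct (alternates_side g y z N true Hz) as (s & Hs & Hside).
    assert (Hnear : forall b c, omega_mod f x (2 ^ S k) (i + b * 2 ^ k) c ->
      forall eps, eps > 0 -> exists q, (2 * q >= N)%nat /\ Rabs (iter (2 * q + b) g y - c) < eps).
    { intros b c Hc eps He. apply omega_iter_iff in Hc; [|apply pow2_pos].
      destruct (Hc eps He N) as (n & Hn & Hd). exists n. split; [lia|].
      unfold g, y. rewrite iter_mul, <- iter_add. rewrite iter_mul, <- iter_add in Hd.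
      replace ((2 * n + b) * 2 ^ k + i)%nat with (n * 2 ^ S k + (i + b * 2 ^ k))%nat
        by (rewrite Nat.pow_succ_r'; lia). exact Hd. }
    assert (Hi0 : forall c, omega_mod f x (2 ^ S k) i c -> s * c <= s * z).
    { intros c Hc. apply limit_le_of_close; auto. intros eps He.
      destruct (Hnear 0%nat c) with (eps := eps) as (q & Hq & Hd); auto.
      { now rewrite Nat.add_0_r. }
      exists (iter (2 * q + 0) g y). split; auto.
      specialize (Hside (2 * q + 0)%nat ltac:(lia)). now rewrite even_2_add in Hside. }
    assert (Hwz : - s * w <= - s * z).
    { apply limit_le_of_close; [destruct Hs as [-> | ->]; [right|left]; lra|]. intros eps He.
      destruct (Hnear 1%nat w Hw eps He) as (q & Hq & Hd).
      exists (iter (2 * q + 1) g y). split; auto.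
      specialize (Hside (2 * q + 1)%nat ltac:(lia)). rewrite even_2_add in Hside. simpl Nat.even in Hside.
      simpl Bool.eqb in Hside. cbv iota in Hside. lra. }
    assert (A1 := Hi0 _ H1). assert (A2 := Hi0 _ H2).
    (* Limits satisfy only weak inequalities, so [y1 <= w <= y2] leaves the case [w = z]: a fixed
       point in the limit set. *)
    assert (Ewz : w = z) by (destruct Hs as [-> | ->]; lra). subst z.
    exact (infinite_omega_no_fixpoint g y w Hgg Hgi Ez Hwg).
Qed.

(** * The Cantor set of a shrinking horseshoe *)

(** Take the first point [b'] where [h] reaches [d], then the last [a'] before it with value [c]; in
    between [h] cannot leave [[c, d]]. *)
Lemma onto_subinterval_up h a b c d : continuity h -> a <= b -> c <= d -> h a = c -> h b = d ->
  exists a' b', a <= a' /\ a' <= b' /\ b' <= b /\ (forall y, a' <= y <= b' -> c <= h y <= d) /\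
    h a' = c /\ h b' = d.
Proof.
  intros Hh Hab Hcd Ea Eb.
  destruct (Req_dec c d) as [E|Hne].
  { exists a, a. repeat split; try lra; replace y with a by lra; lra. }
  assert (a <> b) by (intros ->; lra).
  destruct (first_zero (fun y => h y - d) a b) as (b' & Hb' & Eb' & Hl); try lra.
  { apply continuity_minus; auto. apply continuity_const. intros ? ?; auto. }
  destruct (last_zero (fun y => c - h y) a b') as (a' & Ha' & Ea' & Hl'); try lra.
  { apply continuity_minus; auto. apply continuity_const. intros ? ?; auto. }
  exists a', b'. repeat split; try lra.
  - destruct (Req_dec y a') as [->|]; [lra|]. specialize (Hl' y ltac:(lra)). lra.
  - destruct (Req_dec y b') as [->|]; [lra|]. specialize (Hl y ltac:(lra)). lra.
Qed.

Lemma onto_subinterval h a b c d : continuity h -> a <= b -> c <= d ->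
  (forall p, c <= p <= d -> exists y, a <= y <= b /\ h y = p) ->
  exists a' b', a <= a' /\ a' <= b' /\ b' <= b /\ (forall y, a' <= y <= b' -> c <= h y <= d) /\
    forall p, c <= p <= d -> exists y, a' <= y <= b' /\ h y = p.
Proof.
  intros Hh Hab Hcd H.
  destruct (H c ltac:(lra)) as (s & Hs & Es). destruct (H d ltac:(lra)) as (t & Ht & Et).
  destruct (Rle_dec s t) as [Hst|Hst].
  - destruct (onto_subinterval_up h s t c d Hh Hst Hcd Es Et)
      as (a' & b' & A1 & A2 & A3 & A4 & A5 & A6).
    exists a', b'. repeat split; try lra; [apply A4; auto..|]. intros p Hp. apply ivt; auto; lra.
  - destruct (onto_subinterval_up (fun y => h (- y)) (- s) (- t) c d)
      as (a' & b' & A1 & A2 & A3 & A4 & A5 & A6); rewrite ?Ropp_involutive; try lra.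
    { apply (continuity_comp (fun y => - y) h); auto.
      apply (continuity_opp (fun y => y)), derivable_continuous, derivable_id. }
    exists (- b'), (- a'). repeat split; try lra.
    + specialize (A4 (- y)). rewrite Ropp_involutive in A4. apply A4; lra.
    + specialize (A4 (- y)). rewrite Ropp_involutive in A4. apply A4; lra.
    + intros p Hp. apply ivt_dec; auto; lra.
Qed.

(** A horseshoe with legs that vary with time: leg [b] at stage [k] is [[lo k b, hi k b]], and
    [duration k] iterations spread either leg over both legs of the next stage. *)
Record scheme := { step_map : R -> R; lo : nat -> bool -> R; hi : nat -> bool -> R; duration : nat -> nat }.

Record horseshoe (sc : scheme) : Prop := {
  hs_continuity : continuity (step_map sc);
  hs_le : forall k b, lo sc k b <= hi sc k b;
  hs_cover : forall k b b' p, lo sc (k + 1) b' <= p <= hi sc (k + 1) b' ->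
    exists q, lo sc k b <= q <= hi sc k b /\ iter (duration sc k) (step_map sc) q = p;
  hs_disjoint : forall k p q, lo sc k false <= p <= hi sc k false ->
    lo sc k true <= q <= hi sc k true -> p <> q;
  hs_time : forall k, (1 <= duration sc k)%nat }.

Fixpoint elapsed (sc : scheme) (k : nat) : nat :=
  match k with O => O | S k => (duration sc k + elapsed sc k)%nat end.

Definition on_leg (sc : scheme) (k : nat) (b : bool) (y : R) : Prop :=
  lo sc k b <= iter (elapsed sc k) (step_map sc) y <= hi sc k b.

(** Into the leg, so that the points of [I] follow it; onto the leg, so that the next legs can be
    pulled back into [I]. *)
Definition leg_branch (sc : scheme) (k : nat) (b : bool) (I : R * R) : Prop :=
  fst I <= snd I /\ (forall y, fst I <= y <= snd I -> on_leg sc k b y) /\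
  forall p, lo sc k b <= p <= hi sc k b ->
    exists y, fst I <= y <= snd I /\ iter (elapsed sc k) (step_map sc) y = p.

Definition child (sc : scheme) (k : nat) (b : bool) (I : R * R) : R * R :=
  epsilon (inhabits (0, 0)) (fun I' => fst I <= fst I' /\ snd I' <= snd I /\ leg_branch sc (k + 1) b I').

Definition width (I : R * R) : R := snd I - fst I.

(* Bits at positions [0 mod 3] are [0], which makes points of the Cantor set proximal and leaves
   gaps; those at positions [1 mod 3] select the shorter subinterval, which makes lengths tend to [0];
   those at positions [2 mod 3] run through the parameter [w], each bit of it infinitely often. *)
Definition next_bit (sc : scheme) (w : nat -> bool) (k : nat) (I : R * R) : bool :=
  match (k + 1) mod 3 with
  | 0 => false
  | 1 => if Rle_dec (width (child sc k false I)) (width (child sc k true I)) then false else true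
  | _ => w (fst (of_nat ((k + 1) / 3)))
  end%nat.

Fixpoint node (sc : scheme) (w : nat -> bool) (k : nat) : R * R :=
  match k with
  | O => (lo sc 0 false, hi sc 0 false)
  | S k => child sc k (next_bit sc w k (node sc w k)) (node sc w k)
  end.

Definition itinerary (sc : scheme) (w : nat -> bool) (k : nat) : bool :=
  match k with O => false | S k => next_bit sc w k (node sc w k) end.

Lemma child_spec sc k b c I : horseshoe sc -> leg_branch sc k c I ->
  fst I <= fst (child sc k b I) /\ snd (child sc k b I) <= snd I /\ leg_branch sc (k + 1) b (child sc k b I).
Proof.
  intros HS (H1 & H2 & H3). unfold child. apply epsilon_spec.
  destruct (onto_subinterval (iter (elapsed sc (k + 1)) (step_map sc)) (fst I) (snd I)
    (lo sc (k + 1) b) (hi sc (k + 1) b)) as (a' & b' & A1 & A2 & A3 & A4 & A5); auto.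
  - apply continuity_iter, hs_continuity; auto.
  - now apply hs_le.
  - intros p Hp. destruct (hs_cover sc HS k c b p Hp) as (q & Hq & Eq).
    destruct (H3 q Hq) as (y & Hy & Ey). exists y. split; auto.
    rewrite Nat.add_1_r. simpl. now rewrite iter_add, Ey.
  - exists (a', b'). simpl. repeat split; auto; intros; now apply A4.
Qed.

Lemma node_branch sc w k : horseshoe sc -> leg_branch sc k (itinerary sc w k) (node sc w k).
Proof.
  intros HS. induction k as [|k IH].
  - split; [now apply hs_le|]. split; [auto|]. intros p Hp. exists p. auto.
  - simpl. rewrite <- (Nat.add_1_r k). now apply (child_spec sc k _ (itinerary sc w k)).
Qed.

Lemma node_nested sc w k m : horseshoe sc ->
  fst (node sc w k) <= fst (node sc w (m + k)) /\ snd (node sc w (m + k)) <= snd (node sc w k).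
Proof.
  intros HS. induction m as [|m IH]; [simpl; lra|].
  assert (A := child_spec sc (m + k) (next_bit sc w (m + k) (node sc w (m + k))) _ _ HS
    (node_branch sc w (m + k) HS)). simpl. lra.
Qed.

(** Bit [k + 1] of an itinerary reads [w] at an index at most [(k + 1) / 3], hence depends only on
    [w] up to [k]. *)
Lemma node_agree sc w w' k : (forall i, (i < k)%nat -> w i = w' i) ->
  node sc w k = node sc w' k /\ itinerary sc w k = itinerary sc w' k.
Proof.
  induction k as [|k IH]; intros H; [auto|].
  destruct (IH ltac:(auto)) as (E & _).
  assert (B : next_bit sc w k (node sc w k) = next_bit sc w' k (node sc w' k)).
  { rewrite <- E. unfold next_bit. rewrite H; auto.
    assert (A := to_nat_non_decreasing (fst (of_nat ((k + 1) / 3))) (snd (of_nat ((k + 1) / 3)))).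
    rewrite <- surjective_pairing, cancel_to_of in A.
    assert (C := Nat.div_lt (k + 1) 3 ltac:(lia) ltac:(lia)). lia. }
  simpl. now rewrite <- B, E.
Qed.

(** The children are subintervals of [I], disjoint because the legs that they reach are. *)
Lemma children_length sc k c I : horseshoe sc -> leg_branch sc k c I ->
  width (child sc k false I) + width (child sc k true I) <= width I.
Proof.
  intros HS HI. unfold width.
  destruct (child_spec sc k false c I HS HI) as (A1 & A2 & A3 & A4 & _).
  destruct (child_spec sc k true c I HS HI) as (B1 & B2 & B3 & B4 & _).
  assert (D : forall y, fst (child sc k false I) <= y <= snd (child sc k false I) ->
    fst (child sc k true I) <= y <= snd (child sc k true I) -> False).
  { intros y Hy Hy'. apply (hs_disjoint sc HS (k + 1) _ _ (A4 y Hy) (B4 y Hy')). reflexivity. }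
  destruct (Rle_lt_dec (fst (child sc k false I)) (fst (child sc k true I))) as [L|L].
  - assert (snd (child sc k false I) < fst (child sc k true I)); [|lra].
    apply Rnot_le_lt. intros L'. apply (D (fst (child sc k true I))); lra.
  - assert (snd (child sc k true I) < fst (child sc k false I)); [|lra].
    apply Rnot_le_lt. intros L'. apply (D (fst (child sc k false I))); lra.
Qed.

Lemma node_halved sc w q : horseshoe sc ->
  width (node sc w (3 * q + 1)) <= width (node sc w (3 * q)) / 2.
Proof.
  intros HS. assert (E : ((3 * q + 1) mod 3 = 1)%nat)
    by (rewrite (Nat.mul_comm 3), mod_add_mult; reflexivity).
  set (n := (3 * q)%nat) in *. clearbody n.
  assert (A := children_length sc n _ _ HS (node_branch sc w n HS)).
  replace (node sc w (n + 1)) with (child sc n (next_bit sc w n (node sc w n)) (node sc w n))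
    by now rewrite Nat.add_1_r.
  unfold next_bit. rewrite E. destruct Rle_dec; lra.
Qed.

Lemma node_length sc w q : horseshoe sc ->
  width (node sc w (3 * q + 1)) <= width (node sc w 0) * (/ 2) ^ q.
Proof.
  intros HS. induction q as [|q IH].
  - simpl pow. assert (A := node_nested sc w 0 1 HS). unfold width. simpl Nat.mul. simpl Nat.add in *. lra.
  - assert (A := node_halved sc w (S q) HS).
    assert (B := node_nested sc w (3 * q + 1) 2 HS).
    replace (2 + (3 * q + 1))%nat with (3 * S q)%nat in B by lia.
    simpl pow. unfold width in *. lra.
Qed.

Lemma node_small sc w eps : horseshoe sc -> eps > 0 ->
  exists k, forall m, (m >= k)%nat -> width (node sc w m) < eps.
Proof.
  intros HS He. set (L := width (node sc w 0)).
  assert (HL : 0 <= L) by (assert (A := proj1 (node_branch sc w 0 HS)); unfold L, width; lra).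
  destruct (pow_lt_1_zero (/ 2) ltac:(rewrite Rabs_right; lra) (eps / (L + 1))) as (q & Hq).
  { apply Rdiv_lt_0_compat; lra. }
  exists (3 * q + 1)%nat. intros m Hm.
  specialize (Hq q (le_n q)). rewrite Rabs_right in Hq by (apply Rle_ge, pow_le; lra).
  assert (A := node_length sc w q HS). fold L in A.
  assert (B := node_nested sc w (3 * q + 1) (m - (3 * q + 1)) HS).
  replace (m - (3 * q + 1) + (3 * q + 1))%nat with m in B by lia.
  assert (C : (L + 1) * (/ 2) ^ q < eps).
  { replace eps with ((L + 1) * (eps / (L + 1))) by (field; lra). apply Rmult_lt_compat_l; lra. }
  assert (D : 0 <= (/ 2) ^ q) by (apply pow_le; lra).
  unfold width in *. nra.
Qed.

Definition branch_point (sc : scheme) (w : nat -> bool) (y : R) : Prop :=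
  forall k, fst (node sc w k) <= y <= snd (node sc w k).

Lemma exists_branch_point sc w : horseshoe sc -> exists y, branch_point sc w y.
Proof.
  intros HS.
  assert (Hlt : forall k m, fst (node sc w k) <= snd (node sc w m)).
  { intros k m. assert (A := node_nested sc w k m HS). assert (B := node_nested sc w m k HS).
    rewrite Nat.add_comm in B. assert (C := proj1 (node_branch sc w (m + k) HS)). lra. }
  destruct (completeness (fun y => exists k, y = fst (node sc w k))) as (y & H1 & H2).
  { exists (snd (node sc w 0)). intros y (k & ->). apply Hlt. }
  { exists (fst (node sc w 0)). eauto. }
  exists y. intros k. split.
  - apply H1. eauto.
  - apply H2. intros z (m & ->). apply Hlt.
Qed.

Lemma branch_point_on_leg sc w y k : horseshoe sc -> branch_point sc w y ->
  on_leg sc k (itinerary sc w k) y.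
Proof. intros HS Hy. apply (node_branch sc w k HS). apply Hy. Qed.

Lemma branch_point_unique sc w w' y z : horseshoe sc -> (forall i, w i = w' i) ->
  branch_point sc w y -> branch_point sc w' z -> y = z.
Proof.
  intros HS Hw Hy Hz. apply Rabs_all_lt_eq. intros eps He.
  destruct (node_small sc w eps HS He) as (k & Hk). specialize (Hk k (le_n k)).
  specialize (Hy k). specialize (Hz k).
  destruct (node_agree sc w w' k ltac:(auto)) as (E & _). rewrite <- E in Hz.
  unfold width in Hk. apply Rabs_def1; lra.
Qed.

Lemma itinerary_zero sc w q : itinerary sc w (3 * q + 3) = false.
Proof.
  assert (E : ((3 * q + 2 + 1) mod 3 = 0)%nat).
  { replace (3 * q + 2 + 1)%nat with ((q + 1) * 3 + 0)%nat by lia. apply mod_add_mult. }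
  replace (3 * q + 3)%nat with (3 * q + 2 + 1)%nat by lia.
  set (n := (3 * q + 2)%nat) in *. clearbody n. rewrite Nat.add_1_r. simpl itinerary.
  unfold next_bit. now rewrite E.
Qed.

Lemma itinerary_differs sc w w' i N : w i <> w' i ->
  exists j, (j >= N)%nat /\ itinerary sc w j <> itinerary sc w' j.
Proof.
  (* Pairing [i] with [N] gives a position beyond [N] that carries the bit [w i]. *)
  intros H. set (q := to_nat (i, N)).
  assert (A : (N <= q)%nat).
  { assert (A := to_nat_non_decreasing i N). unfold q. lia. }
  exists (3 * q + 2)%nat. split; [lia|].
  assert (E : ((3 * q + 2) mod 3 = 2 /\ (3 * q + 2) / 3 = q)%nat).
  { rewrite (Nat.mul_comm 3), mod_add_mult, Nat.div_add_l by lia. split; [reflexivity|].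
    simpl. lia. }
  destruct E as (E1 & E2). replace (3 * q + 2)%nat with (3 * q + 1 + 1)%nat in * by lia.
  set (n := (3 * q + 1)%nat) in *. clearbody n. rewrite !(Nat.add_1_r n). simpl itinerary.
  unfold next_bit. rewrite E1, E2. unfold q. now rewrite cancel_of_to.
Qed.

Lemma distinct_branch_points sc w w' y z i : horseshoe sc -> w i <> w' i ->
  branch_point sc w y -> branch_point sc w' z -> y <> z.
Proof.
  intros HS Hi Hy Hz ->. destruct (itinerary_differs sc w w' i 0 Hi) as (j & _ & Hj).
  assert (A := branch_point_on_leg sc w z j HS Hy). assert (B := branch_point_on_leg sc w' z j HS Hz).
  unfold on_leg in A, B. destruct (itinerary sc w j), (itinerary sc w' j); try congruence.
  - now apply (hs_disjoint sc HS j _ _ B A).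
  - now apply (hs_disjoint sc HS j _ _ A B).
Qed.

Definition cantor_of (sc : scheme) (y : R) : Prop := exists w, branch_point sc w y.

(** Prefixes are extended one bit at a time; bit [i] no longer changes from stage [S i] on, so the
    diagonal [pre (S i) i] agrees with every stage on its prefix. *)
Lemma bool_compactness (P : nat -> (nat -> bool) -> Prop) :
  (forall k w w', (forall i, (i < k)%nat -> w i = w' i) -> P k w -> P k w') ->
  (exists w, P 0%nat w) ->
  (forall k w, P k w -> exists w', (forall i, (i < k)%nat -> w i = w' i) /\ P (k + 1)%nat w') ->
  exists w, forall k, P k w.
Proof.
  intros Hext (w0 & H0) Hstep.
  set (next := fun k w => epsilon (inhabits w0)
    (fun w' => (forall i, (i < k)%nat -> w i = w' i) /\ P (k + 1)%nat w')).
  set (pre := fix pre k := match k with O => w0 | S k => next k (pre k) end).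
  assert (Hpre : forall k, P k (pre k)).
  { induction k as [|k IH]; auto. rewrite <- Nat.add_1_r at 1. simpl.
    exact (proj2 (epsilon_spec (inhabits w0) _ (Hstep k (pre k) IH))). }
  assert (Hagree : forall k m i, (i < k)%nat -> pre k i = pre (m + k)%nat i).
  { intros k m i Hi. induction m as [|m IH]; auto. rewrite IH. simpl.
    apply (proj1 (epsilon_spec (inhabits w0) _ (Hstep (m + k)%nat (pre (m + k)%nat) (Hpre _)))). lia. }
  exists (fun i => pre (S i) i). intros k. apply (Hext k (pre k)); auto. intros i Hi.
  rewrite (Hagree (S i) (k - S i)%nat i) by lia. f_equal. lia.
Qed.

(** If points with a given prefix accumulate at [y], so do those with one of its two extensions,
    whence a full sequence [w]. Each of its nodes is closed and has points arbitrarily near [y]. *)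
Lemma cantor_of_closed sc y : horseshoe sc ->
  (forall eps, eps > 0 -> exists z, cantor_of sc z /\ Rabs (z - y) < eps) -> cantor_of sc y.
Proof.
  intros HS Hy.
  set (P := fun k w => forall eps, eps > 0 -> exists w' z, (forall i, (i < k)%nat -> w i = w' i) /\
    branch_point sc w' z /\ Rabs (z - y) < eps).
  destruct (bool_compactness P) as (w & Hw).
  - intros k w w' Hww H eps He. destruct (H eps He) as (v & z & A & B). exists v, z. split; auto.
    intros i Hi. now rewrite <- Hww, A.
  - exists (fun _ => false). intros eps He. destruct (Hy eps He) as (z & (w & Hw) & Hd).
    exists w, z. split; [intros; lia|auto].
  - intros k w H. apply NNPP. intros Hn.
    set (upd := fun b i => if Nat.eq_dec i k then b else w i).
    assert (Hfail : forall b, exists e, e > 0 /\ forall v z, (forall i, (i < k)%nat -> w i = v i) ->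
      v k = b -> branch_point sc v z -> e <= Rabs (z - y)).
    { intros b. apply NNPP. intros Hb. apply Hn. exists (upd b). split.
      - intros i Hi. unfold upd. destruct Nat.eq_dec; [lia|auto].
      - intros eps He. apply NNPP. intros Hno. apply Hb. exists eps. split; auto.
        intros v z Hv Hvk Hz. apply Rnot_lt_le. intros Hlt. apply Hno. exists v, z. split; auto.
        intros i Hi. unfold upd. destruct Nat.eq_dec; [congruence|apply Hv; lia]. }
    destruct (Hfail true) as (e1 & He1 & F1), (Hfail false) as (e2 & He2 & F2).
    destruct (H (Rmin e1 e2)) as (v & z & Hv & Hz & Hd); [now apply Rmin_glb_lt|].
    assert (A1 := Rmin_l e1 e2). assert (A2 := Rmin_r e1 e2).
    destruct (v k) eqn:Ev.
    + specialize (F1 v z Hv Ev Hz). lra.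
    + specialize (F2 v z Hv Ev Hz). lra.
  - exists w. intros k. split; apply Rnot_lt_le; intros L.
    + destruct (Hw k (fst (node sc w k) - y)) as (w' & z & Ha & Hz & Hd); [lra|].
      specialize (Hz k). destruct (node_agree sc w w' k Ha) as (E & _). rewrite <- E in Hz.
      apply Rabs_def2 in Hd. lra.
    + destruct (Hw k (y - snd (node sc w k))) as (w' & z & Ha & Hz & Hd); [lra|].
      specialize (Hz k). destruct (node_agree sc w w' k Ha) as (E & _). rewrite <- E in Hz.
      apply Rabs_def2 in Hd. lra.
Qed.

(** Flipping parameter bit [k] changes the point but not node [k], which is already shorter than
    [eps]. *)
Lemma cantor_of_perfect sc y : horseshoe sc -> cantor_of sc y ->
  forall eps, eps > 0 -> exists z, cantor_of sc z /\ z <> y /\ Rabs (z - y) < eps.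
Proof.
  intros HS (w & Hw) eps He. destruct (node_small sc w eps HS He) as (k & Hk).
  specialize (Hk k (le_n k)).
  set (w' := fun i => if Nat.eq_dec i k then negb (w i) else w i).
  destruct (exists_branch_point sc w' HS) as (z & Hz). exists z. split; [now exists w'|]. split.
  - apply not_eq_sym, (distinct_branch_points sc w w' y z k); auto.
    unfold w'. destruct Nat.eq_dec; [|lia]. now destruct (w k).
  - destruct (node_agree sc w w' k) as (E & _).
    { intros i Hi. unfold w'. destruct Nat.eq_dec; [lia|auto]. }
    specialize (Hw k). specialize (Hz k). rewrite <- E in Hz. unfold width in Hk.
    apply Rabs_def1; lra.
Qed.

(* A short interval around a point contains the subinterval with itinerary bit [1] at a position
   where points of the Cantor set have bit [0]. *)
Lemma cantor_of_no_interval sc a b : horseshoe sc -> a < b -> exists z, a < z < b /\ ~ cantor_of sc z.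
Proof.
  intros HS Hab. destruct (classic (cantor_of sc ((a + b) / 2))) as [(w & Hw)|H].
  2:{ exists ((a + b) / 2). split; auto. lra. }
  destruct (node_small sc w ((b - a) / 2) HS ltac:(lra)) as (k & Hk).
  specialize (Hk (3 * k + 2)%nat ltac:(lia)).
  destruct (child_spec sc (3 * k + 2) true _ _ HS (node_branch sc w (3 * k + 2) HS))
    as (A1 & A2 & A3 & A4 & _).
  set (I := child sc (3 * k + 2) true (node sc w (3 * k + 2))) in *.
  exists (fst I). specialize (Hw (3 * k + 2)%nat). unfold width in Hk. split; [lra|].
  intros (w' & Hw'). assert (B := branch_point_on_leg sc w' (fst I) (3 * k + 3) HS Hw').
  rewrite itinerary_zero in B. specialize (A4 (fst I) ltac:(lra)).
  replace (3 * k + 2 + 1)%nat with (3 * k + 3)%nat in A4 by lia.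
  now apply (hs_disjoint sc HS (3 * k + 3) _ _ B A4).
Qed.

Lemma cantor_of_cantor_set sc : horseshoe sc ->
  (forall y, lo sc 0 false <= y <= hi sc 0 false -> inI y) -> cantor_set_in_I (cantor_of sc).
Proof.
  intros HS HI. split; [|split; [|split; [|split]]].
  - intros y (w & Hw). apply HI. exact (Hw 0%nat).
  - destruct (exists_branch_point sc (fun _ => false) HS) as (y & Hy). exists y. now exists (fun _ => false).
  - intros y. now apply cantor_of_closed.
  - intros y Hy. now apply cantor_of_perfect.
  - intros a b. now apply cantor_of_no_interval.
Qed.

(** Diagonal argument: [diag n] is false exactly when some parameter whose point has index [n] has
    its bit [n] true. Injectivity makes all parameters of index [g (pt diag)] agree with [diag], a
    contradiction at that bit. *)
Lemma cantor_of_uncountable sc : horseshoe sc -> uncountable (cantor_of sc).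
Proof.
  intros HS (g & Hg).
  set (pt := fun w => epsilon (inhabits 0) (branch_point sc w)).
  assert (Hpt : forall w, branch_point sc w (pt w)).
  { intros w. apply epsilon_spec. now apply exists_branch_point. }
  set (diag := fun n => if excluded_middle_informative (exists w, g (pt w) = n /\ w n = true)
    then false else true).
  assert (Hsame : forall w n, g (pt w) = g (pt diag) -> w n = diag n).
  { intros w n E. assert (Ept : pt w = pt diag) by (apply Hg; auto; eexists; apply Hpt).
    destruct (Bool.bool_dec (w n) (diag n)) as [|Hne]; auto. exfalso.
    exact (distinct_branch_points sc w diag _ _ n HS Hne (Hpt w) (Hpt diag) Ept). }
  set (n := g (pt diag)).
  destruct (diag n) eqn:E; assert (E' := E); unfold diag in E';
    destruct excluded_middle_informative as [(w & Hw & Hwn)|H]; try discriminate.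
  - apply H. exists diag. auto.
  - rewrite (Hsame w n Hw) in Hwn. congruence.
Qed.

Lemma elapsed_ge sc k : horseshoe sc -> (k <= elapsed sc k)%nat.
Proof. intros HS. induction k; simpl; auto. assert (A := hs_time sc HS k). lia. Qed.

Lemma cantor_of_scrambled sc delta : horseshoe sc ->
  (forall eps, eps > 0 -> exists K, forall k, (k >= K)%nat -> hi sc k false - lo sc k false < eps) ->
  (forall eps, eps > 0 -> exists K, forall k, (k >= K)%nat -> forall p q,
     lo sc k false <= p <= hi sc k false -> lo sc k true <= q <= hi sc k true ->
     delta - eps < Rabs (p - q)) ->
  delta_scrambled_set (step_map sc) delta (cantor_of sc).
Proof.
  intros HS Hsmall Hfar y z (w & Hy) (w' & Hz) Hyz. split.
  - intros eps He N. destruct (Hsmall eps He) as (K & HK).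
    set (k := (3 * (N + K) + 3)%nat). exists (elapsed sc k).
    assert (A := elapsed_ge sc k HS). split; [unfold k in *; lia|].
    assert (B := branch_point_on_leg sc w y k HS Hy). assert (C := branch_point_on_leg sc w' z k HS Hz).
    unfold k in B, C. rewrite itinerary_zero in B, C. fold k in B, C.
    specialize (HK k ltac:(unfold k; lia)). unfold on_leg in B, C. apply Rabs_def1; lra.
  - intros eps He N. destruct (Hfar eps He) as (K & HK).
    assert (Hi : exists i, w i <> w' i).
    { apply NNPP. intros Hn. apply Hyz. apply (branch_point_unique sc w w'); auto.
      intros i. apply NNPP. intros H. apply Hn. eauto. }
    destruct Hi as (i & Hi). destruct (itinerary_differs sc w w' i (N + K) Hi) as (j & Hj & Hd).
    exists (elapsed sc j). assert (A := elapsed_ge sc j HS). split; [lia|].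
    assert (B := branch_point_on_leg sc w y j HS Hy). assert (C := branch_point_on_leg sc w' z j HS Hz).
    specialize (HK j ltac:(lia)). unfold on_leg in B, C.
    destruct (itinerary sc w j), (itinerary sc w' j); try congruence.
    + rewrite Rabs_minus_sym. now apply Rlt_gt, HK.
    + now apply Rlt_gt, HK.
Qed.

(** * Equivalence *)

(** Only the intervals are nested by definition; as hulls of different classes are disjoint, the
    residues are nested too. The endpoints of the intersection are then limits of the [a k] and
    [b k] inside nested closed limit sets. *)
Lemma nonseparable_limits f u v : good f -> nonseparable_pair f u v ->
  exists x i, inI x /\ infinite_set (omega f x) /\ coherent i /\
    (forall k, omega_mod f x (2 ^ k) (i k) (Rmin u v)) /\
    (forall k, omega_mod f x (2 ^ k) (i k) (Rmax u v)).
Proof.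
  intros Hg (Huv & x & Hx & Hinf & i & a & b & HJ & Hn & Hz).
  exists x, i. split; auto. split; auto.
  assert (HJ' : forall k, (k >= 1)%nat -> is_min (omega_mod f x (2 ^ k) (i k)) (a k) /\
    is_max (omega_mod f x (2 ^ k) (i k)) (b k)).
  { intros k Hk. now apply IsJ_iff, HJ. }
  assert (Hmono : forall k m, (k >= 1)%nat -> a k <= a (m + k)%nat /\ b (m + k)%nat <= b k).
  { intros k m Hk. induction m as [|m IH]; [simpl; lra|].
    destruct (Hn (m + k)%nat ltac:(lia)). simpl. lra. }
  assert (Hmax := Rmax_l u v). assert (Hmin := Rmin_l u v).
  assert (Hlt : Rmin u v <= Rmax u v) by lra.
  assert (Hin1 := proj2 (Hz (Rmin u v)) ltac:(lra)).
  assert (Hin2 := proj2 (Hz (Rmax u v)) ltac:(lra)).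
  assert (Hcoh : coherent i).
  { apply step_coherent. intros [|k]; [reflexivity|].
    destruct (HJ' (S k) ltac:(lia)) as ((A1 & A2) & (A3 & A4)).
    destruct (HJ' (S (S k)) ltac:(lia)) as ((B1 & _) & _).
    symmetry. apply (omega_mod_hulls_disjoint f x (S k) _ _ (a (S k)) (b (S k)) (a (S (S k)))); auto.
    - now apply (omega_mod_pow2_le f x (S k) (S (S k))); [lia|].
    - destruct (Hn (S k) ltac:(lia)). specialize (Hin1 (S (S k)) ltac:(lia)). lra. }
  assert (Hdown : forall k k' y, (k <= k')%nat -> omega_mod f x (2 ^ k') (i k') y ->
    omega_mod f x (2 ^ k) (i k) y).
  { intros k k' y Hk Hy. apply (omega_mod_congr _ _ _ _ _ _ (Hcoh k k' Hk)).
    now apply (omega_mod_pow2_le f x k k'). }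
  split; auto. split; intros k; apply omega_mod_closed; intros eps He; apply NNPP; intros Hno.
  - assert (Hfar : forall m, (m >= 1)%nat -> (m >= k)%nat -> a m <= Rmin u v - eps).
    { intros m Hm Hmk. apply Rnot_lt_le. intros L. apply Hno. exists (a m). split.
      - apply (Hdown k m); auto. now apply HJ'.
      - specialize (Hin1 m Hm). apply Rabs_def1; lra. }
    assert (A : Rmin u v <= Rmin u v - eps); [|lra].
    apply (proj1 (Hz _)). intros m Hm. specialize (Hin1 m Hm).
    destruct (Hmono m k Hm). specialize (Hfar (k + m)%nat ltac:(lia) ltac:(lia)). lra.
  - assert (Hfar : forall m, (m >= 1)%nat -> (m >= k)%nat -> Rmax u v + eps <= b m).
    { intros m Hm Hmk. apply Rnot_lt_le. intros L. apply Hno. exists (b m). split.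
      - apply (Hdown k m); auto. now apply HJ'.
      - specialize (Hin2 m Hm). apply Rabs_def1; lra. }
    assert (A : Rmax u v + eps <= Rmax u v); [|lra].
    apply (proj1 (Hz _)). intros m Hm. specialize (Hin2 m Hm).
    destruct (Hmono m k Hm). specialize (Hfar (k + m)%nat ltac:(lia) ltac:(lia)). lra.
Qed.

Lemma side_interval s w e y : sign s -> 0 <= e ->
  Rmin w (w + s * e) <= y <= Rmax w (w + s * e) <-> side s w e y.
Proof.
  unfold side. intros [-> | ->] He.
  - rewrite Rmin_left, Rmax_right by lra. split; lra.
  - rewrite Rmin_right, Rmax_left by lra. split; lra.
Qed.

(** Uncountability is part of the conclusion because Li-Yorke chaos is derived from this same
    set. *)
Lemma nonseparable_cantor f u v : good f -> (forall x, inI (f x)) -> nonseparable_pair f u v ->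
  exists delta K, delta > 0 /\ cantor_set_in_I K /\ delta_scrambled_set f delta K /\ uncountable K.
Proof.
  intros Hg HI Hns. assert (Huv := proj1 Hns).
  destruct (nonseparable_limits f u v Hg Hns) as (x & i & Hx & Hinf & Hi & Hu & Hv).
  assert (Hlt : Rmin u v < Rmax u v).
  { destruct (Rle_dec u v); [rewrite Rmin_left, Rmax_right|rewrite Rmin_right, Rmax_left]; lra. }
  revert Hu Hv Hlt. generalize (Rmin u v) (Rmax u v). clear u v Hns Huv. intros u v Hu Hv Huv.
  destruct (limit_one_sided f x i u Hg Hinf Hi Hu) as (su & Hsu & Hvu).
  destruct (limit_one_sided f x i v Hg Hinf Hi Hv) as (sv & Hsv & Hvv).
  assert (HIx : forall n, inI (iter n f x)) by (intros [|n]; simpl; auto).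
  (* A quarter of [v - u] keeps legs of length at most [e0] disjoint, whatever their sides. The leg
     at [u] contains the Cantor set; ending it at an orbit point keeps it in the unit interval. *)
  assert (He0 : exists e, 0 < e < (v - u) / 4 /\ forall y, side su u e y -> inI y).
  { assert (HuI : inI u).
    { assert (A : forall eps, eps > 0 -> - eps < u < 1 + eps).
      { intros eps He. destruct (Hu 0%nat eps He 0%nat) as (n & _ & _ & Hd).
        apply Rabs_def2 in Hd. destruct (HIx n). lra. }
      split; apply Rnot_lt_le; intros L.
      - specialize (A (- u)). lra.
      - specialize (A (u - 1)). lra. }
    destruct (Hvu ((v - u) / 4) ltac:(lra) 0%nat 0%nat) as (n & _ & _ & Hn).
    exists (su * (iter n f x - u)). split; auto. intros y Hy. destruct (HIx n), HuI.
    unfold side, inI in *. destruct Hsu as [-> | ->]; lra. }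
  destruct He0 as (e0 & He0 & HeI).
  assert (Hstep : forall e, exists et : R * nat, 0 < e -> 0 < fst et < e / 2 /\ (1 <= snd et)%nat /\
    forall p, side su u (fst et) p \/ side sv v (fst et) p ->
      (exists q, side su u e q /\ iter (snd et) f q = p) /\
      (exists q, side sv v e q /\ iter (snd et) f q = p)).
  { intros e. destruct (Rlt_le_dec 0 e) as [He|He].
    - destruct (shrinking_horseshoe f x i su u sv v e Hg Hinf Hi Hsu Hsv Hvu Hvv He)
        as (e' & t & A). exists (e', t). intros _. exact A.
    (* A dummy value: [choice] asks for one at every [e]. *)
    - exists (0, 0%nat). lra. }
  destruct (choice _ Hstep) as (st & Hst).
  set (e := fix e k := match k with O => e0 | S k => fst (st (e k)) end).
  assert (Hepos : forall k, 0 < e k).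
  { induction k as [|k IH]; simpl; [lra|]. now apply Hst. }
  assert (Hehalf : forall k, e k <= e0 * (/ 2) ^ k).
  { induction k as [|k IH]; [simpl; lra|]. destruct (Hst (e k) (Hepos k)) as (A & _). simpl in *. lra. }
  assert (Hele : forall k, e k <= e0).
  { intros k. assert (A := Hehalf k). assert (B : (/ 2) ^ k <= 1).
    { rewrite <- (pow1 k). apply pow_incr. lra. }
    nra. }
  assert (Hlim : forall eps, eps > 0 -> exists K, forall k, (k >= K)%nat -> e k < eps).
  { intros eps He. destruct (pow_lt_1_zero (/ 2) ltac:(rewrite Rabs_right; lra) (eps / e0)) as (K & HK).
    { apply Rdiv_lt_0_compat; lra. }
    exists K. intros k Hk. specialize (HK k Hk). rewrite Rabs_right in HK by (apply Rle_ge, pow_le; lra).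
    eapply Rle_lt_trans; [apply Hehalf|]. replace eps with (e0 * (eps / e0)) by (field; lra).
    apply Rmult_lt_compat_l; lra. }
  set (leg := fun (b : bool) => if b then side sv v else side su u).
  set (sc := {| step_map := f;
    lo := fun k b => if b then Rmin v (v + sv * e k) else Rmin u (u + su * e k);
    hi := fun k b => if b then Rmax v (v + sv * e k) else Rmax u (u + su * e k);
    duration := fun k => snd (st (e k)) |}).
  assert (Hleg : forall k b y, lo sc k b <= y <= hi sc k b <-> leg b (e k) y).
  { intros k b y. specialize (Hepos k). destruct b; simpl; apply side_interval; auto; lra. }
  assert (Hsep : forall k p q, lo sc k false <= p <= hi sc k false -> lo sc k true <= q <= hi sc k true ->
    v - u - 2 * e k <= Rabs (p - q)).
  { intros k p q Hp Hq. apply Hleg in Hp, Hq. simpl in Hp, Hq. unfold side in Hp, Hq.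
    rewrite Rabs_minus_sym. apply Rle_trans with (q - p); [|apply Rle_abs].
    destruct Hsu as [-> | ->], Hsv as [-> | ->]; lra. }
  assert (HS : horseshoe sc).
  { split.
    - exact (proj1 Hg).
    - intros k []; simpl; (eapply Rle_trans; [apply Rmin_l|apply Rmax_l]).
    - intros k b b' p Hp. apply Hleg in Hp. destruct (Hst (e k) (Hepos k)) as (_ & _ & A).
      rewrite Nat.add_1_r in Hp. simpl e in Hp.
      destruct (A p) as ((q1 & B1 & C1) & (q2 & B2 & C2)).
      { destruct b'; [right|left]; exact Hp. }
      destruct b; [exists q2|exists q1]; split; auto; now apply Hleg.
    - intros k p q Hp Hq ->. assert (A := Hsep k q q Hp Hq). specialize (Hele k).
      replace (q - q) with 0 in A by ring. rewrite Rabs_R0 in A. lra.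
    - intros k. now apply (Hst (e k) (Hepos k)). }
  exists (v - u), (cantor_of sc). split; [lra|]. split; [|split].
  - apply cantor_of_cantor_set; auto. intros y Hy. apply HeI. now apply (Hleg 0%nat false).
  - apply (cantor_of_scrambled sc (v - u)); auto.
    + intros eps He. destruct (Hlim eps He) as (K & HK). exists K. intros k Hk.
      specialize (HK k Hk). specialize (Hepos k). simpl.
      destruct Hsu as [-> | ->].
      * rewrite Rmin_left, Rmax_right by lra. lra.
      * rewrite Rmin_right, Rmax_left by lra. lra.
    + intros eps He. destruct (Hlim (eps / 2)) as (K & HK); [lra|]. exists K. intros k Hk p q Hp Hq.
      specialize (HK k Hk). assert (A := Hsep k p q Hp Hq). lra.
  - now apply cantor_of_uncountable.
Qed.

Lemma proximal_transfer f g x y : (forall n, iter n f x = iter n g x) ->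
  (forall n, iter n f y = iter n g y) -> proximal f x y -> proximal g x y.
Proof.
  intros Hx Hy H eps He N. destruct (H eps He N) as (n & Hn & Hd). exists n. now rewrite <- Hx, <- Hy.
Qed.

Lemma scrambled_pair_transfer f g x y : (forall n, iter n f x = iter n g x) ->
  (forall n, iter n f y = iter n g y) -> scrambled_pair f x y -> scrambled_pair g x y.
Proof.
  intros Hx Hy (Hp & Ha). split.
  - exact (proximal_transfer f g x y Hx Hy Hp).
  - intros H. apply Ha. intros eps He. destruct (H eps He) as (N & HN). exists N. intros n Hn.
    rewrite Hx, Hy. auto.
Qed.

Lemma delta_scrambled_pair_transfer f g d x y : (forall n, iter n f x = iter n g x) ->
  (forall n, iter n f y = iter n g y) -> delta_scrambled_pair f d x y -> delta_scrambled_pair g d x y.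
Proof.
  intros Hx Hy (Hp & Ha). split.
  - exact (proximal_transfer f g x y Hx Hy Hp).
  - intros eps He N. destruct (Ha eps He N) as (n & Hn & Hd). exists n. now rewrite <- Hx, <- Hy.
Qed.

Lemma omega_transfer f g x r i y : (forall n, iter n f x = iter n g x) ->
  omega (iter r f) (iter i f x) y -> omega (iter r g) (iter i g x) y.
Proof.
  intros Hx H eps He N. destruct (H eps He N) as (n & Hn & Hd). exists n. split; auto.
  rewrite iter_mul, <- iter_add in *. now rewrite <- Hx.
Qed.

Lemma nonseparable_pair_transfer f g u v : (forall x n, inI x -> iter n f x = iter n g x) ->
  nonseparable_pair f u v -> nonseparable_pair g u v.
Proof.
  intros Hfg (Huv & x & Hx & Hinf & i & a & b & HJ & Hrest). split; auto.
  assert (Hfg' : forall n, iter n f x = iter n g x) by auto.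
  assert (Hgf' : forall n, iter n g x = iter n f x) by (intros; symmetry; auto).
  exists x. split; auto. split.
  - intros l. destruct (Hinf l) as (y & Hy & Hn). exists y. split; auto.
    exact (omega_transfer f g x 1 0 y Hfg' Hy).
  - exists i, a, b. split; auto. intros k Hk. destruct (HJ k Hk) as (Hi & (A1 & A2) & (A3 & A4)).
    split; auto. split; (split; [now apply (omega_transfer f g)|]); intros y Hy;
      [apply A2|apply A4]; now apply (omega_transfer g f).
Qed.

Lemma delta_scrambled_is_scrambled f d x y : d > 0 -> delta_scrambled_pair f d x y ->
  scrambled_pair f x y.
Proof.
  intros Hd (Hp & Hl). split; auto. intros Ha. destruct (Ha (d / 2)) as (N & HN); [lra|].
  destruct (Hl (d / 2) ltac:(lra) N) as (n & Hn & Hlt). specialize (HN n Hn). lra.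
Qed.

Theorem mainTheorem11 (f : R -> R) (Hf : selfmap_I f) (Hh : zero_entropy f) :
  (li_yorke_chaotic f <->
     exists x y, inI x /\ inI y /\ scrambled_pair f x y) /\
  ((exists x y, inI x /\ inI y /\ scrambled_pair f x y) <->
     exists delta K, delta > 0 /\ cantor_set_in_I K /\ delta_scrambled_set f delta K) /\
  ((exists delta K, delta > 0 /\ cantor_set_in_I K /\ delta_scrambled_set f delta K) <->
     exists u v, nonseparable_pair f u v).
Proof.
  assert (Hg := good_extend f Hf Hh).
  assert (Hit : forall x n, inI x -> iter n (extend f) x = iter n f x)
    by (intros; now apply iter_extend).
  assert (Hit' : forall x n, inI x -> iter n f x = iter n (extend f) x)
    by (intros; symmetry; auto).
  assert (H12 : li_yorke_chaotic f -> exists x y, inI x /\ inI y /\ scrambled_pair f x y).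
  { intros (C & HI & Hunc & HC). apply NNPP. intros Hn. apply Hunc. exists (fun _ => 0%nat).
    intros x y Hx Hy _. apply NNPP. intros Hxy. apply Hn. exists x, y. auto. }
  assert (H24 : (exists x y, inI x /\ inI y /\ scrambled_pair f x y) ->
    exists u v, nonseparable_pair f u v).
  { intros (x & y & Hx & Hy & Hs).
    destruct (scrambled_nonseparable (extend f) x y Hg Hx Hy) as (u & v & Huv).
    - apply (scrambled_pair_transfer f); auto.
    - exists u, v. apply (nonseparable_pair_transfer (extend f)); auto. }
  assert (H4 : (exists u v, nonseparable_pair f u v) -> exists delta K, delta > 0 /\
    cantor_set_in_I K /\ delta_scrambled_set f delta K /\ uncountable K).
  { intros (u & v & Huv).
    destruct (nonseparable_cantor (extend f) u v Hg) as (d & K & Hd & HK & Hs & Hu).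
    - intros x. now apply extend_inI.
    - apply (nonseparable_pair_transfer f); auto.
    - exists d, K. split; auto. split; auto. split; auto. intros x y Hx Hy Hxy.
      destruct HK as (HI & _).
      apply (delta_scrambled_pair_transfer (extend f)); auto. }
  assert (H32 : (exists delta K, delta > 0 /\ cantor_set_in_I K /\ delta_scrambled_set f delta K) ->
    exists x y, inI x /\ inI y /\ scrambled_pair f x y).
  { intros (d & K & Hd & (HI & (x & Hx) & _ & Hperf & _) & Hs).
    destruct (Hperf x Hx 1 ltac:(lra)) as (y & Hy & Hxy & _).
    exists x, y. split; auto. split; auto. apply (delta_scrambled_is_scrambled f d); auto. }
  split; [|split]; split; auto.
  - intros H2. destruct (H4 (H24 H2)) as (d & K & Hd & HK & Hs & Hu). exists K.
    split; [apply HK|]. split; auto. intros x y Hx Hy Hxy.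
    apply (delta_scrambled_is_scrambled f d); auto.
  - intros H2. destruct (H4 (H24 H2)) as (d & K & Hd & HK & Hs & _). eauto.
  - intros H. destruct (H4 H) as (d & K & Hd & HK & Hs & _). eauto.
Qed.
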